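(* On the unit ball $\mathbb{B}^n\subset\mathbb{C}^n$, $n\ge 1$, take $u\equiv1$ and $\phi\equiv0$. Then $W_{1,0}$ is a rank-one orthogonal projection on $A^2(\mathbb{B}^n)$, and $$W_{1,0}\in S_q(A^2(\mathbb{B}^n)),\qquad\|W_{1,0}\|_{S_q}^q=1\quad(q>0).$$ Nevertheless, $$\mathcal{I}_q(1,0)<\infty\quad\Longleftrightarrow\quad q>\frac{2n}{n+1}.$$ In particular, the implication $W_{u,\phi}\in S_q\Rightarrow\mathcal{I}_q(u,\phi)<\infty$ fails for every $0<q\le\frac{2n}{n+1}$, even on the unit ball.
   Context: $\mathbb{B}^n=\{z\in\mathbb{C}^n:|z|<1\}$, $dV$ is Lebesgue measure, and $A^2(\mathbb{B}^n)$ is the space of holomorphic functions in $L^2(\mathbb{B}^n,dV)$, with Bergman (reproducing) kernel $K(z,w)=c_n(1-\langle z,w\rangle)^{-(n+1)}$, $c_n=1/|\mathbb{B}^n|$. $d\lambda(z)=K(z,z)\,dV(z)$. For a holomorphic self-map $\phi$ of $\mathbb{B}^n$ and a holomorphic function $u$ on $\mathbb{B}^n$, $W_{u,\phi}f=u\,(f\circ\phi)$, $$B_{u,\phi}(z)=\frac1{K(z,z)}\int_{\mathbb{B}^n}|K(z,\phi(\zeta))|^2|u(\zeta)|^2\,dV(\zeta),\qquad\mathcal{I}_q(u,\phi)=\int_{\mathbb{B}^n}B_{u,\phi}(z)^{q/2}\,d\lambda(z).$$ $S_q(H)$ is the set of compact operators $T$ on $H$ with $\|T\|_{S_q}^q=\sum_k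 s_k(T)^q<\infty$, $s_k(T)$ being the singular values. *)

(* Defs.v *)
From HB Require Import structures.
From mathcomp Require Import all_boot all_order all_algebra.
From mathcomp Require Import complex.
From mathcomp Require Import all_classical all_reals all_analysis.

Set Implicit Arguments.
Unset Strict Implicit.
Unset Printing Implicit Defensive.

Import Order.TTheory GRing.Theory Num.Theory.
Import numFieldNormedType.Exports.

Local Open Scope classical_set_scope.
Local Open Scope ring_scope.

#[local] Set Warnings "-redundant-canonical-projection".
Section complex_normed_module.
Variable R : realType.
HB.instance Definition _ := PseudoPointedMetric.copy R[i] (R[i])^o.
HB.instance Definition _ := GRing.ComAlgebra.copy R[i] (R[i])^o.
HB.instance Definition _ := Vector.copy R[i] (R[i])^o.
HB.instance Definition _ := NormedModule.copy R[i] (R[i])^o.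
End complex_normed_module.

Lemma product_measure_sigma_finite d1 d2 (T1 : measurableType d1)
    (T2 : measurableType d2) (R : realType)
    (m1 : {sigma_finite_measure set T1 -> \bar R})
    (m2 : {sigma_finite_measure set T2 -> \bar R}) :
  sigma_finite setT (m1 \x m2)%E.
Proof.
have /sigma_finiteP[F [TF ndF Foo]] := sigma_finiteT m1.
have /sigma_finiteP[G [TG ndG Goo]] := sigma_finiteT m2.
exists (fun i => F i `*` G i).
  rewrite -setXTT TF TG predeqE => -[x y]; split.
    move=> [/= [k _ Fkx] [l _ Gly]]; exists (maxn k l) => //; split.
    - by move: x Fkx; exact/subsetPset/ndF/leq_maxl.
    - by move: y Gly; exact/subsetPset/ndG/leq_maxr.
  by move=> [k _ []/= ? ?]; split; exists k.
move=> i; have [? ?] := Foo i; have [? ?] := Goo i; split.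
  exact: measurableX.
by rewrite product_measure1E// lte_mul_pinfty// ge0_fin_numE.
Qed.

Section tuple_measure_cons.
Local Open Scope ereal_scope.
Context d (T : measurableType d) (R : realType) (n : nat).
Variable mu : {sigma_finite_measure set T -> \bar R}.
Variable nu : {sigma_finite_measure set (n.-tuple T) -> \bar R}.

Let tcons (p : T * n.-tuple T) : n.+1.-tuple T := [tuple of p.1 :: p.2].

Let measurable_tcons : measurable_fun setT tcons.
Proof. exact: measurable_cons. Qed.

Let tuncons (x : n.+1.-tuple T) : T * n.-tuple T :=
  (thead x, [tuple of behead x]).

Let measurable_tuncons : measurable_fun setT tuncons.
Proof.
apply/measurable_fun_pair; last exact: measurable_behead.
exact: measurable_tnth.
Qed.

Definition tuple_measure_cons : set (n.+1.-tuple T) -> \bar R :=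
  pushforward (mu \x nu) tcons.

HB.instance Definition _ := Measure.copy tuple_measure_cons
  (measure_function_pushforward__canonical__measure_function_Measure
     (mu \x nu) measurable_tcons).

Let tuple_measure_cons_sigma_finite : sigma_finite setT tuple_measure_cons.
Proof.
have [F FT Foo] := product_measure_sigma_finite mu nu.
exists (fun i => tuncons @^-1` F i); first by rewrite -preimage_bigcup -FT.
move=> i; have [mF Fi] := Foo i; split.
  by rewrite -[X in measurable X]setTI; exact: measurable_tuncons.
rewrite /tuple_measure_cons /pushforward -comp_preimage.
rewrite (_ : tuncons \o tcons = id)//.
by apply/funext => -[x t]; congr pair; apply/val_inj.
Qed.

HB.instance Definition _ := Measure_isSigmaFinite.Build _ _ _
  tuple_measure_cons tuple_measure_cons_sigma_finite.
End tuple_measure_cons.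

Section tuple_measure.
Context d (T : measurableType d) (R : realType).
Variable mu : {sigma_finite_measure set T -> \bar R}.

(* The n-fold product of mu, as a measure on n-tuples; the empty product is
   the unit mass at the empty tuple. *)
Fixpoint tuple_measure (n : nat) :
    {sigma_finite_measure set (n.-tuple T) -> \bar R} :=
  if n is m.+1 then tuple_measure_cons mu (tuple_measure m)
  else dirac [tuple].
End tuple_measure.

Section plane_measure.
Variable R : realType.

Definition plane_measure :
    set (measurableTypeR R * measurableTypeR R) -> \bar R :=
  (@lebesgue_measure R \x @lebesgue_measure R)%E.

HB.instance Definition _ := Measure.copy plane_measure
  (@lebesgue_measure R \x @lebesgue_measure R)%E.

Let plane_measure_sigma_finite : sigma_finite setT plane_measure.
Proof. exact: product_measure_sigma_finite. Qed.

HB.instance Definition _ := Measure_isSigmaFinite.Build _ _ _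
  plane_measure plane_measure_sigma_finite.
End plane_measure.

Local Notation normc := ComplexField.Normc.normc.

Section complex_space_measure.
Variables (R : realType) (n : nat).
Local Notation Cn := 'rV[R[i]]_n.

(* C^n carries the sigma-algebra transported from (R^2)^n along the bijection
   cvec, that is, the Borel one. *)
Definition cvec (t : n.-tuple (measurableTypeR R * measurableTypeR R)) : Cn :=
  \row_j (((tnth t j).1 : R) +i* (tnth t j).2)%C.

Definition cvec_display : measure_display.
Proof. exact: default_measure_display. Qed.

Lemma cvec_measurable0 : measurable (cvec @^-1` set0).
Proof. by rewrite preimage_set0. Qed.

Lemma cvec_measurableC (A : set Cn) :
  measurable (cvec @^-1` A) -> measurable (cvec @^-1` (~` A)).
Proof. by move=> mA; rewrite preimage_setC; exact: measurableC. Qed.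

Lemma cvec_measurable_bigcup (F : (set Cn)^nat) :
  (forall i, measurable (cvec @^-1` F i)) ->
  measurable (cvec @^-1` (\bigcup_i F i)).
Proof. by move=> mF; rewrite preimage_bigcup; exact: bigcup_measurable. Qed.

HB.instance Definition _ := @isMeasurable.Build cvec_display Cn
  (fun A => measurable (cvec @^-1` A))
  cvec_measurable0 cvec_measurableC cvec_measurable_bigcup.

Lemma measurable_cvec : measurable_fun setT cvec.
Proof. by move=> _ A mA; rewrite setTI. Qed.

(* Lebesgue measure, transported from (R^2)^n. *)
Definition dV : set Cn -> \bar R :=
  pushforward (tuple_measure (@plane_measure R) n) cvec.

HB.instance Definition _ := Measure.copy dV
  (measure_function_pushforward__canonical__measure_function_Measure
     (tuple_measure (@plane_measure R) n) measurable_cvec).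

End complex_space_measure.

Section bergman_space.
Variables (R : realType) (n : nat).
Local Notation Cn := 'rV[R[i]]_n.
Local Notation dV := (@dV R n).

Definition cdot (z w : Cn) : R[i] := \sum_j z 0 j * (w 0 j)^*%C.

Definition unit_ball : set Cn := [set z | Num.sqrt (complex.Re (cdot z z)) < 1].

Definition ball_holomorphic (W : normedModType R[i]) (f : Cn -> W) : Prop :=
  forall z, unit_ball z -> differentiable f z.

Definition ball_holomorphic_self_map (phi : Cn -> Cn) : Prop :=
  ball_holomorphic phi /\ (forall z, unit_ball z -> unit_ball (phi z)).

Definition cintegral (D : set Cn) (f : Cn -> R[i]) : R[i] :=
  (\int[dV]_(z in D) complex.Re (f z) +i* \int[dV]_(z in D) complex.Im (f z))%C.

(* A function on the ball is encoded by its extension by 0 to C^n, so that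
   equality of functions on the ball is Leibniz equality. *)
Definition A2 : set (Cn -> R[i]) :=
  [set f | [/\ ball_holomorphic f,
    (\int[dV]_(z in unit_ball) (normc (f z) ^+ 2)%:E < +oo)%E &
    forall z, ~ unit_ball z -> f z = 0]].

Definition A2dot (f g : Cn -> R[i]) : R[i] :=
  cintegral unit_ball (fun z => f z * (g z)^*%C).

(* The normalising constant is c_n = 1 / |B^n|. *)
Definition bergman_kernel (z w : Cn) : R[i] :=
  ((fine (dV unit_ball))^-1)%:C%C * (1 - cdot z w) ^- n.+1.

Definition weighted_comp (u : Cn -> R[i]) (phi : Cn -> Cn)
    (f : Cn -> R[i]) : Cn -> R[i] :=
  patch (cst 0) unit_ball (fun z => u z * f (phi z)).

Definition berezin (u : Cn -> R[i]) (phi : Cn -> Cn) (z : Cn) : \bar R :=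
  ((complex.Re (bergman_kernel z z))^-1%:E *
   \int[dV]_(w in unit_ball)
     (normc (bergman_kernel z (phi w)) ^+ 2 * normc (u w) ^+ 2)%:E)%E.

(* Integration of B_{u,phi}^(q/2) against d lambda = K(z,z) dV. *)
Definition berezin_integral (q : R) (u : Cn -> R[i]) (phi : Cn -> Cn) : \bar R :=
  (\int[dV]_(z in unit_ball)
     (berezin u phi z `^ (q / 2) * (complex.Re (bergman_kernel z z))%:E))%E.
End bergman_space.

Section hilbert_operators.
Variables (R : realType) (V : lmodType R[i]).

(* dim E = m, for a linear subspace E of V. *)
Definition has_dim (E : set V) (m : nat) : Prop :=
  exists e : 'I_m -> V,
    [/\ forall i, E (e i),
        forall c : 'I_m -> R[i],
          \sum_i c i *: e i = 0 -> forall i, c i = 0 &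
        forall v, E v -> exists c : 'I_m -> R[i], v = \sum_i c i *: e i].

(* The Hilbert space is a linear subspace H of V, with inner product ip;
   operators on H are functions on V, of which only the values on H matter. *)
Variables (H : set V) (ip : V -> V -> R[i]).

Definition hnorm (f : V) : R := Num.sqrt (complex.Re (ip f f)).

Definition linear_operator (T : V -> V) : Prop :=
  (forall f, H f -> H (T f)) /\
  (forall (a : R[i]) f g, H f -> H g -> T (a *: f + g) = a *: T f + T g).

Definition bounded_operator (T : V -> V) : Prop :=
  linear_operator T /\
  exists M : R, forall f, H f -> hnorm (T f) <= M * hnorm f.

Definition compact_operator (T : V -> V) : Prop :=
  linear_operator T /\
  forall f : nat -> V, (forall k, H (f k)) ->
    (exists M : R, forall k, hnorm (f k) <= M) ->
    exists l : nat -> nat, {homo l : i j / (i < j)%N} /\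
      exists2 g, H g & (fun k => hnorm (T (f (l k)) - g)) @ \oo --> (0 : R).

Definition is_adjoint (T S : V -> V) : Prop :=
  (forall f, H f -> H (S f)) /\
  (forall f g, H f -> H g -> ip (T f) g = ip f (S g)).

Definition orthogonal_projection (P : V -> V) : Prop :=
  [/\ bounded_operator P, forall f, H f -> P (P f) = P f & is_adjoint P P].

Definition has_rank (T : V -> V) (m : nat) : Prop := has_dim (T @` H) m.

(* The singular values of T are the square roots of the eigenvalues of T^* T,
   in nonincreasing order, repeated according to multiplicity and followed by
   zeros if there are only finitely many nonzero ones. *)
Definition is_singular_values (T : V -> V) (s : nat -> R) : Prop :=
  exists2 S, is_adjoint T S &
    [/\ forall k, 0 <= s k,
        {homo s : i j / (i <= j)%N >-> j <= i} &
        forall mu : R, 0 < mu -> exists2 m : nat,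
          ([set k | s k = mu] #= `I_m)%card &
          has_dim [set f | H f /\ S (T f) = ((mu ^+ 2)%:C)%C *: f] m].

Definition singular_values (T : V -> V) : nat -> R :=
  xget (cst 0) (is_singular_values T).

(* The q-th power of the Schatten q-norm. *)
Definition schatten_norm_pow (q : R) (T : V -> V) : \bar R :=
  (\sum_(0 <= k <oo) (singular_values T k `^ q)%:E)%E.

Definition schatten_class (q : R) : set (V -> V) :=
  [set T | compact_operator T /\ (schatten_norm_pow q T < +oo)%E].
End hilbert_operators.

(* Main.v *)
(* For the given data the operator sends f to the constant function f(0) on
   the ball.  It is self-adjoint by the mean value property
   [\int_B f dV = f(0) |B|]: the rotations z |-> e^(it) z preserve dV, so one
   may average over t first, and the circle means of f(e^(it) z) are f(0) by
   Goursat's bisection argument applied to (x, y) |-> f(e^(x + iy) z), which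
   only needs pointwise complex differentiability.  The equality case of
   [|f(0)|^2 |B| <= \|f\|^2] determines every adjoint on constants, and the
   singular values are 1, 0, 0, ...

   On the other hand B_{1,0}(z) = (1 - |z|^2)^(n+1), so that I_q is |B|^-1 times
   the integral of (1 - |z|^2)^s with s = (n+1)(q/2 - 1).  By homogeneity
   [dV {|z|^2 < t} = t^n |B|], so the shells 1 - |z|^2 <= 2^-k have measure
   comparable to 2^-k, and the integral is finite if and only if s > -1. *)
From HB Require Import structures.
Require Import Defs.
From mathcomp Require Import all_boot all_order all_algebra.
From mathcomp Require Import complex.
From mathcomp Require Import all_classical all_reals all_analysis.
From mathcomp Require Import measurable_realfun.
From mathcomp Require Import lra ring.

Set Implicit Arguments.
Unset Strict Implicit.
Unset Printing Implicit Defensive.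

Import Order.TTheory GRing.Theory Num.Theory.
Import numFieldNormedType.Exports.

Local Open Scope classical_set_scope.
Local Open Scope ring_scope.

(** The exponential is chosen because it turns circles about 0 into vertical segments and the
    punctured closed disc into a half-strip. Bisection then only ever concerns rectangles, the
    horizontal sides cancel by periodicity, and the centre, which the exponential misses, is
    recovered by letting [x] tend to minus infinity.

    Members of [A2] vanish off the ball, so even constants jump at the sphere. Measurability is
    therefore read off superlevel sets, and differentiability of constants needs a locality
    argument.

    [singular_values] is selected by [xget] among sequences witnessed by some adjoint [S], so it is
    computable only once uniqueness holds for every [S]. As [P f] is always constant, the eigenvalue
    equation for [S (P f)] involves [S] on constants alone.

    The exponent satisfies [s > -1] exactly when [q > 2 n / (n + 1)]. The assumption [n >= 1] enters
    through the shells: for [n = 0] the ball is a single point without a boundary layer. *)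

Local Notation normc := ComplexField.Normc.normc.

(** * Goursat's theorem on rectangles *)

Section goursat.
Variable R : realType.
Local Notation mu := (@lebesgue_measure R).

Lemma continuous_segment_integrable (f : R -> R) (a b : R) :
  (forall x, a <= x <= b -> {for x, continuous f}) ->
  mu.-integrable `[a, b] (EFin \o f).
Proof.
move=> cf; apply: continuous_compact_integrable; first exact: segment_compact.
apply: continuous_in_subspaceT => x; rewrite inE/= in_itv/= => xab.
exact: cf.
Qed.

Lemma Rintegral_segmentD (f : R -> R) (a m b : R) : a <= m -> m <= b ->
  mu.-integrable `[a, b] (EFin \o f) ->
  \int[mu]_(x in `[a, b]) f x =
  \int[mu]_(x in `[a, m]) f x + \int[mu]_(x in `[m, b]) f x.
Proof.
move=> am mb intf.
have intmb : mu.-integrable `]m, b] (EFin \o f).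
  by apply: integrableS intf => //; apply: subset_itvr; rewrite bnd_simp.
rewrite -(Rintegral_itv_obnd_cbnd intmb) -(@Rintegral_itvB _ f (BLeft a) _ m)//.
by rewrite addrC subrK.
Qed.

(** Serves twice: to compare the circulation round a small rectangle with its linear approximation,
    and to let circles shrink to the centre in the mean value property. *)
Lemma Rintegral_segment_near (f : R -> R) (a b k e : R) : a <= b ->
  mu.-integrable `[a, b] (EFin \o f) ->
  (forall x, a <= x <= b -> `|f x - k| <= e) ->
  `|\int[mu]_(x in `[a, b]) f x - k * (b - a)| <= e * (b - a).
Proof.
move=> ab intf fk.
have intc (c : R) : mu.-integrable `[a, b] (EFin \o cst c).
  by apply: continuous_segment_integrable => x _; exact: cvg_cst.
have cE (c : R) : \int[mu]_(x in `[a, b]) c = c * (b - a).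
  rewrite Rintegral_cst//= lebesgue_measure_itv/= lte_fin.
  by case: ltgtP ab => // -> _; rewrite subrr.
have h1 : \int[mu]_(x in `[a, b]) f x <= \int[mu]_(x in `[a, b]) (k + e).
  apply: le_Rintegral => // [|x/=]; first exact: intc.
  by rewrite in_itv/= => /fk; rewrite ler_norml; clear; lra.
have h2 : \int[mu]_(x in `[a, b]) (k - e) <= \int[mu]_(x in `[a, b]) f x.
  apply: le_Rintegral => // [|x/=]; first exact: intc.
  by rewrite in_itv/= => /fk; rewrite ler_norml; clear; lra.
rewrite !cE in h1 h2; rewrite ler_norml; move: h1 h2; clear; lra.
Qed.

Lemma normr_sub_endpoints (a x b : R) :
  a <= x <= b -> `|a - x| + `|b - x| = b - a.
Proof. by move=> axb; rewrite ler0_norm ?ger0_norm; lra. Qed.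

(** The line integral of [P dx + Q dy] counterclockwise round the boundary, with opposite sides
    paired under one integral so that increments across the rectangle can be estimated directly. *)
Definition rect_circulation (P Q : R -> R -> R) (a b c d : R) : R :=
  \int[mu]_(y in `[c, d]) (Q b y - Q a y) -
  \int[mu]_(x in `[a, b]) (P x d - P x c).

(* The common coefficient B expresses dP/dy = dQ/dx at (x, y). *)
Definition closed_form_at (P Q : R -> R -> R) (x y : R) : Prop :=
  exists A B C : R, forall e, 0 < e -> exists2 del, 0 < del &
    forall x' y', `|x' - x| < del -> `|y' - y| < del ->
    `|P x' y' - P x y - (A * (x' - x) + B * (y' - y))|
      <= e * (`|x' - x| + `|y' - y|) /\
    `|Q x' y' - Q x y - (B * (x' - x) + C * (y' - y))|
      <= e * (`|x' - x| + `|y' - y|).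

(** Separate continuity is enough for what follows: integrands run along horizontal or vertical
    sides, where it gives integrability. *)
Lemma closed_form_at_continuous P Q x y : closed_form_at P Q x y ->
  [/\ {for x, continuous (P ^~ y)}, {for y, continuous (P x)},
      {for x, continuous (Q ^~ y)} & {for y, continuous (Q x)}].
Proof.
move=> [A [B [C H]]]; have [del del0 {}H] := H 1 ltr01.
have key (f : R -> R) (t k : R) :
    (forall t', `|t' - t| < del -> `|f t' - f t - k * (t' - t)| <= `|t' - t|) ->
    {for t, continuous f}.
  move=> Hf; apply/cvgrPdist_le => e e0.
  apply/nbhs_ballP; exists (Num.min del (e / (`|k| + 1))) => /=.
    by rewrite lt_min del0 divr_gt0// ltr_wpDl.
  move=> t'; rewrite /ball/= distrC lt_min => /andP[td te].
  have Hf' := Hf _ td.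
  rewrite ltr_pdivlMr ?ltr_wpDl// mulrC mulrDl mul1r in te.
  have := ler_normD (f t' - f t - k * (t' - t)) (k * (t' - t)).
  rewrite subrK normrM distrC.
  move: Hf' te; clear; lra.
split.
- apply: (key _ _ A) => x' xx'; have := (H x' y xx' _).1.
  by rewrite subrr normr0 !(mulr0, addr0, mul1r); exact.
- apply: (key _ _ B) => y' yy'; have := (H x y' _ yy').1.
  by rewrite subrr normr0 !(mulr0, add0r, mul1r); exact.
- apply: (key _ _ B) => x' xx'; have := (H x' y xx' _).2.
  by rewrite subrr normr0 !(mulr0, addr0, mul1r); exact.
- apply: (key _ _ C) => y' yy'; have := (H x y' _ yy').2.
  by rewrite subrr normr0 !(mulr0, add0r, mul1r); exact.
Qed.

Section rectangle.
Variables (P Q : R -> R -> R) (a0 b0 c0 d0 : R).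
Hypothesis PQ : forall x y, a0 <= x <= b0 -> c0 <= y <= d0 ->
  closed_form_at P Q x y.

Let intP a b y : a0 <= a -> b <= b0 -> c0 <= y <= d0 ->
  mu.-integrable `[a, b] (EFin \o (P ^~ y)).
Proof.
move=> a0a bb0 yI; apply: continuous_segment_integrable => x xI.
have xI0 : a0 <= x <= b0 by lra.
by have [] := closed_form_at_continuous (PQ xI0 yI).
Qed.

Let intQ c d x : c0 <= c -> d <= d0 -> a0 <= x <= b0 ->
  mu.-integrable `[c, d] (EFin \o Q x).
Proof.
move=> c0c dd0 xI; apply: continuous_segment_integrable => y yI.
have yI0 : c0 <= y <= d0 by lra.
by have [] := closed_form_at_continuous (PQ xI yI0).
Qed.

Let circE a b c d : a0 <= a -> a <= b -> b <= b0 -> c0 <= c -> c <= d ->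
    d <= d0 ->
  rect_circulation P Q a b c d =
  \int[mu]_(y in `[c, d]) Q b y - \int[mu]_(y in `[c, d]) Q a y -
  (\int[mu]_(x in `[a, b]) P x d - \int[mu]_(x in `[a, b]) P x c).
Proof.
move=> *; rewrite /rect_circulation RintegralB//; [|by apply: intQ; lra..].
by rewrite RintegralB//; apply: intP; lra.
Qed.

Let circ_splitx a m b c d : a0 <= a -> a <= m -> m <= b -> b <= b0 ->
    c0 <= c -> c <= d -> d <= d0 ->
  rect_circulation P Q a b c d =
  rect_circulation P Q a m c d + rect_circulation P Q m b c d.
Proof.
move=> *; rewrite !circE//; try lra.
rewrite (@Rintegral_segmentD _ a m b)//; last by apply: intP; lra.
rewrite (@Rintegral_segmentD (P ^~ c) a m b)//; last by apply: intP; lra.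
lra.
Qed.

Let circ_splity a b c m d : a0 <= a -> a <= b -> b <= b0 ->
    c0 <= c -> c <= m -> m <= d -> d <= d0 ->
  rect_circulation P Q a b c d =
  rect_circulation P Q a b c m + rect_circulation P Q a b m d.
Proof.
move=> *; rewrite !circE//; try lra.
rewrite (@Rintegral_segmentD _ c m d)//; last by apply: intQ; lra.
rewrite (@Rintegral_segmentD (Q a) c m d)//; last by apply: intQ; lra.
lra.
Qed.

(** In the differences across opposite sides the terms in [A] and [C] cancel, and the common [B]
    contributes [B * (b - a) * (d - c)] to both integrals, hence nothing to their difference. Only
    the error terms remain. *)
Let circ_small x y e : a0 <= x <= b0 -> c0 <= y <= d0 -> 0 < e ->
  exists2 del, 0 < del & forall a b c d,
    a0 <= a -> a <= x <= b -> b <= b0 -> c0 <= c -> c <= y <= d -> d <= d0 ->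
    (b - a) + (d - c) < del ->
    `|rect_circulation P Q a b c d| <= e * ((b - a) + (d - c)) ^+ 2.
Proof.
move=> xI yI e0; have [A [B [C H]]] := PQ xI yI.
(* Each difference across the rectangle uses the estimate at two points. *)
have e20 : 0 < e / 2 by lra.
have [del del0 {}H] := H _ e20.
exists del => // a b c d a0a axb bb0 c0c cyd dd0 small.
have hQ : `|\int[mu]_(y in `[c, d]) (Q b y - Q a y) - B * (b - a) * (d - c)|
    <= e * ((b - a) + (d - c)) * (d - c).
  apply: Rintegral_segment_near => [||y' y'I]; first lra.
    have iQ := integrableB _ (@intQ c d b _ _ _) (@intQ c d a _ _ _).
    by apply: iQ => //; lra.
  have yy : `|y' - y| <= d - c by rewrite ler_norml; lra.
  have xa : `|a - x| <= b - a by rewrite ler_norml; lra.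
  have xb : `|b - x| <= b - a by rewrite ler_norml; lra.
  have [_ Ha] := H a y' ltac:(lra) ltac:(lra).
  have [_ Hb] := H b y' ltac:(lra) ltac:(lra).
  have xab := normr_sub_endpoints axb.
  have : e / 2 * (`|a - x| + `|y' - y|) + e / 2 * (`|b - x| + `|y' - y|) <=
      e * ((b - a) + (d - c)).
    by rewrite -mulrDr -mulrA ler_wpM2l ?(ltW e0)//; lra.
  move: Ha Hb; rewrite !ler_norml; lra.
have hP : `|\int[mu]_(x in `[a, b]) (P x d - P x c) - B * (d - c) * (b - a)|
    <= e * ((b - a) + (d - c)) * (b - a).
  apply: Rintegral_segment_near => [||x' x'I]; first lra.
    have iP := integrableB _ (@intP a b d _ _ _) (@intP a b c _ _ _).
    by apply: iP => //; lra.
  have xx : `|x' - x| <= b - a by rewrite ler_norml; lra.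
  have yc : `|c - y| <= d - c by rewrite ler_norml; lra.
  have yd : `|d - y| <= d - c by rewrite ler_norml; lra.
  have [Hc _] := H x' c ltac:(lra) ltac:(lra).
  have [Hd _] := H x' d ltac:(lra) ltac:(lra).
  have ycd := normr_sub_endpoints cyd.
  have : e / 2 * (`|x' - x| + `|c - y|) + e / 2 * (`|x' - x| + `|d - y|) <=
      e * ((b - a) + (d - c)).
    by rewrite -mulrDr -mulrA ler_wpM2l ?(ltW e0)//; lra.
  move: Hc Hd; rewrite !ler_norml; lra.
rewrite /rect_circulation; move: hP hQ; rewrite !ler_norml.
set I := (\int[_]_(_ in _) _); set J := (\int[_]_(_ in _) _).
rewrite expr2 => /andP[? ?] /andP[? ?]; apply/andP; split; lra.
Qed.

Let rect : Type := (R * R * (R * R))%type.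
Let F (s : rect) := `|rect_circulation P Q s.1.1 s.1.2 s.2.1 s.2.2|.
Let inside (s : rect) := [&& a0 <= s.1.1, s.1.1 <= s.1.2, s.1.2 <= b0,
  c0 <= s.2.1, s.2.1 <= s.2.2 & s.2.2 <= d0].
Let subrect (s t : rect) := [&& t.1.1 <= s.1.1, s.1.2 <= t.1.2,
  t.2.1 <= s.2.1 & s.2.2 <= t.2.2].
Let perim (s : rect) := (s.1.2 - s.1.1) + (s.2.2 - s.2.1).

(** Circulation is additive, so one of the four quarters carries at least a quarter of it in
    absolute value. The factor 4 is matched by the square of [perim] (half the perimeter) in
    [circ_small]. *)
Let quarter (s : rect) : inside s ->
  exists t, [/\ inside t, subrect t s, perim t = perim s / 2 & F s <= 4 * F t].
Proof.
case: s => [[a b] [c d]]; rewrite /inside /subrect /perim /F/= => sI.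
have [m mE] : exists m, m = (a + b) / 2 by eexists.
have [l lE] : exists l, l = (c + d) / 2 by eexists.
have := @circ_splitx a m b c d ltac:(lra) ltac:(lra) ltac:(lra) ltac:(lra)
  ltac:(lra) ltac:(lra) ltac:(lra).
rewrite (@circ_splity a m c l d); try lra.
rewrite (@circ_splity m b c l d); try lra.
set f := rect_circulation _ _ a b c d.
set f1 := rect_circulation _ _ a m c l.
set f2 := rect_circulation _ _ a m l d.
set f3 := rect_circulation _ _ m b c l.
set f4 := rect_circulation _ _ m b l d => fE.
have : `|f| <= `|f1| + `|f2| + (`|f3| + `|f4|).
  rewrite fE; apply: le_trans (ler_normD _ _) _.
  by apply: lerD; exact: ler_normD.
move=> H.
have [h1|h1] := leP `|f| (4 * `|f1|).
  by exists ((a, m), (c, l)); split => //=; rewrite -/f1; lra.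
have [h2|h2] := leP `|f| (4 * `|f2|).
  by exists ((a, m), (l, d)); split => //=; rewrite -/f2; lra.
have [h3|h3] := leP `|f| (4 * `|f3|).
  by exists ((m, b), (c, l)); split => //=; rewrite -/f3; lra.
by exists ((m, b), (l, d)); split => //=; rewrite -/f4; lra.
Qed.

(* Goursat's bisection: no continuity of the partial derivatives is needed. *)
Lemma rect_circulation_eq0 : a0 <= b0 -> c0 <= d0 ->
  rect_circulation P Q a0 b0 c0 d0 = 0.
Proof.
move=> ab cd.
(* Carrying [inside] in the type lets the choice of a quarter be iterated by plain recursion. *)
pose I0 := {s : rect | inside s}.
have s0I : inside ((a0, b0), (c0, d0)) by rewrite /inside/= !lexx ab cd.
have step (s : I0) : {t : I0 | [/\ subrect (sval t) (sval s),
    perim (sval t) = perim (sval s) / 2 & F (sval s) <= 4 * F (sval t)]}.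
  apply: cid; have [t [tI ts tp tF]] := quarter (svalP s).
  by exists (exist (fun s => inside s) t tI).
pose u := fix u (k : nat) : I0 :=
  if k is k'.+1 then sval (step (u k')) else exist (fun s => inside s) _ s0I.
pose v k := sval (u k).
have vI k : inside (v k) by exact: (proj2_sig (u k)).
have vS k : [/\ subrect (v k.+1) (v k), perim (v k.+1) = perim (v k) / 2 &
    F (v k) <= 4 * F (v k.+1)] by exact: (proj2_sig (step (u k))).
have vsub k j : subrect (v (k + j)%N) (v k).
  elim: j => [|j IH]; first by rewrite addn0 /subrect !lexx.
  rewrite addnS; have [+ _ _] := vS (k + j)%N.
  by move: IH; rewrite /subrect; lra.
(* Rectangles [i] and [j] both contain rectangle [i + j], so every lower end lies below every upper
   end; the suprema of the lower ends then give a point common to all rectangles. *)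
have vlr i j : (v i).1.1 <= (v j).1.2 /\ (v i).2.1 <= (v j).2.2.
  have := vsub i j; have := vsub j i; rewrite (addnC j i).
  have := vI (i + j)%N; rewrite /inside /subrect; lra.
have vperim k : perim (v k) = perim (v 0) / 2 ^+ k.
  elim: k => [|k IH]; first by rewrite expr0 divr1.
  by have [_ -> _] := vS k; rewrite IH exprS invfM; ring.
have vF k : F (v 0) <= 4 ^+ k * F (v k).
  elim: k => [|k IH]; first by rewrite expr0 mul1r.
  rewrite exprSr; apply: le_trans IH _; rewrite -mulrA ler_wpM2l// ?exprn_ge0//.
  by have [] := vS k.
pose x := sup (range (fun k => (v k).1.1)).
pose y := sup (range (fun k => (v k).2.1)).
have xP k : (v k).1.1 <= x <= (v k).1.2.
  apply/andP; split.
    apply: ub_le_sup; last by exists k.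
    by exists (v 0).1.2 => _ [j _ <-]; have [] := vlr j 0%N.
  apply: ge_sup; first by exists (v 0).1.1; exists 0%N.
  by move=> _ [j _ <-]; have [] := vlr j k.
have yP k : (v k).2.1 <= y <= (v k).2.2.
  apply/andP; split.
    apply: ub_le_sup; last by exists k.
    by exists (v 0).2.2 => _ [j _ <-]; have [] := vlr j 0%N.
  apply: ge_sup; first by exists (v 0).2.1; exists 0%N.
  by move=> _ [j _ <-]; have [] := vlr j k.
apply: contrapT => /eqP; rewrite -normr_gt0 => F0.
have {F0} : 0 < F (v 0) by [].
set K := F (v 0) => K0.
pose L := perim (v 0).
have L0 : 0 <= L by have := vI 0%N; rewrite /L /perim /inside; lra.
(* With this tolerance the [4 ^+ k] of [vF] is absorbed by the square of [L / 2 ^+ k], leaving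
   [K / 2 * (L ^+ 2 / (L ^+ 2 + 1))], which is less than [K]; the [+ 1] admits [L = 0]. *)
have e0 : 0 < K / (2 * (L ^+ 2 + 1)).
  by rewrite divr_gt0// mulr_gt0// ltr_wpDl// sqr_ge0.
have xI : a0 <= x <= b0 by exact: xP 0%N.
have yI : c0 <= y <= d0 by exact: yP 0%N.
have [del del0 H] := circ_small xI yI e0.
have [k kdel] : exists k, L / 2 ^+ k < del.
  exists (Num.Def.archi_bound (L / del)).
  rewrite ltr_pdivrMr ?exprn_gt0// mulrC -ltr_pdivrMr//.
  apply: lt_le_trans (archi_boundP _) _; first by rewrite divr_ge0// ltW.
  by rewrite -natrX ler_nat ltnW// ltn_expl.
have := vI k; rewrite /inside => /and5P[i1 i2 i3 i4 /andP[i5 i6]].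
have := H _ _ _ _ i1 (xP k) i3 i4 (yP k) i6.
rewrite -/(perim (v k)) vperim -/L => /(_ kdel).
rewrite -/(F (v k)) => Fk.
have := vF k; rewrite leNgt => /negP; apply.
apply: le_lt_trans (ler_wpM2l _ Fk) _; first by rewrite exprn_ge0.
have -> : (4 : R) ^+ k = (2 ^+ k) ^+ 2.
  by rewrite -exprM mulnC exprM; congr (_ ^+ _); rewrite expr2 -natrM.
rewrite [X in X < _](_ : _ = K / 2 * (L ^+ 2 / (L ^+ 2 + 1))); last first.
  have h2 : (2 : R) ^+ k != 0 by rewrite expf_neq0.
  have h3 : L ^+ 2 + 1 != 0 by rewrite gt_eqF// ltr_wpDl// sqr_ge0.
  by field; rewrite h2 h3.
have : L ^+ 2 / (L ^+ 2 + 1) <= 1.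
  rewrite ler_pdivrMr ?mul1r ?lerDl// ltr_wpDl// sqr_ge0//.
rewrite -/K; nra.
Qed.

End rectangle.
End goursat.

(** * Product measures under linear maps *)

Section lebesgue_affine.
Variable R : realType.
Local Notation mu := (@lebesgue_measure R).

Lemma lebesgue_measureDr (a : R) (A : set R) : measurable A ->
  mu ((fun x => x + a) @^-1` A) = mu A.
Proof.
move=> mA.
have mf : measurable_fun setT (fun x : R => x + a : measurableTypeR R).
  exact: measurable_funD.
pose m := measure_function_pushforward__canonical__measure_function_Measure mu
    mf.
apply/esym; apply: (@lebesgue_measure_unique _ m) => //= _ [[u v]] _ <-.
rewrite /m/= /pushforward.
rewrite (_ : _ @^-1` _ = `]u - a, v - a]%classic); last first.
  by apply/seteqP; split => x /=; rewrite !in_itv/=; lra.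
rewrite !lebesgue_measure_itv/= !lte_fin ltrD2r; case: ifP => // _.
by rewrite -!EFinB; congr EFin; ring.
Qed.

Lemma lebesgue_measureMl (r : R) (A : set R) : 0 < r -> measurable A ->
  mu ((fun x => r * x) @^-1` A) = (r^-1%:E * mu A)%E.
Proof.
move=> r0 mA.
have mf : measurable_fun setT (fun x : measurableTypeR R =>
    r * x : measurableTypeR R).
  exact: measurable_funM.
pose m := measure_function_pushforward__canonical__measure_function_Measure mu
    mf.
suff -> : mu A = (r%:E * m A)%E.
  by rewrite muleA -EFinM mulVf ?mul1e// gt_eqF.
apply: (@lebesgue_measure_unique _ (mscale (NngNum (ltW r0)) m)) =>
    //= _ [[u v]] _ <-.
rewrite /mscale/= /m/= /pushforward.
rewrite (_ : _ @^-1` _ = `]u / r, v / r]%classic); last first.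
  by apply/seteqP; split => x /=; rewrite !in_itv/= ltr_pdivrMr// ler_pdivlMr//
      mulrC.
rewrite !lebesgue_measure_itv/= !lte_fin ltr_pM2r ?invr_gt0//; case: ifP => _;
    last by rewrite mule0.
by rewrite -!EFinB -EFinM; congr EFin; field; rewrite gt_eqF.
Qed.

End lebesgue_affine.

Section product_scaling.
Local Open Scope ereal_scope.

(** Preimages are used, so for Lebesgue measure and an invertible linear [f] the factor [c] is the
    inverse of the absolute value of the determinant. *)
Definition scales d (T : measurableType d) (R : realType)
    (m : {measure set T -> \bar R}) (f : T -> T) (c : R) : Prop :=
  forall A, measurable A -> m (f @^-1` A) = c%:E * m A.

Lemma scales_comp d (T : measurableType d) (R : realType)
    (m : {measure set T -> \bar R}) (f g : T -> T) (c c' : R) :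
  measurable_fun setT f -> measurable_fun setT g ->
  scales m f c -> scales m g c' -> scales m (g \o f) (c * c')%R.
Proof.
move=> mf mg sf sg A mA; rewrite comp_preimage sf ?sg ?EFinM ?muleA//.
by rewrite -[X in measurable X]setTI; exact: mg.
Qed.

Context d1 d2 (T1 : measurableType d1) (T2 : measurableType d2) (R : realType).
Variables (m1 : {sigma_finite_measure set T1 -> \bar R}).
Variables (m2 : {sigma_finite_measure set T2 -> \bar R}).

(** Sigma-finiteness reduces the claim to rectangles, on which the pushforward divided by [c1 * c2]
    is the product measure. *)
Lemma product_measure_scales (f1 : T1 -> T1) (f2 : T2 -> T2) (c1 c2 : R) :
  measurable_fun setT f1 -> measurable_fun setT f2 -> (0 < c1)%R ->
      (0 < c2)%R ->
  scales m1 f1 c1 -> scales m2 f2 c2 ->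
  scales (m1 \x m2) (fun x => (f1 x.1, f2 x.2)) (c1 * c2)%R.
Proof.
move=> mf1 mf2 c10 c20 s1 s2 A mA.
have mf : measurable_fun setT (fun x : T1 * T2 => (f1 x.1, f2 x.2)).
  by apply/measurable_fun_pair; apply: measurableT_comp.
pose m := measure_function_pushforward__canonical__measure_function_Measure
  (m1 \x m2) mf.
have c0 : (0 < (c1 * c2)^-1)%R by rewrite invr_gt0 mulr_gt0.
have E : (m1 \x m2) A = (c1 * c2)^-1%:E * m A.
  apply: (@product_measure_unique _ _ _ _ _ m1 m2
    (mscale (NngNum (ltW c0)) m)) => // B C mB mC.
  transitivity ((c1 * c2)^-1%:E *
      (m1 \x m2) ((f1 @^-1` B) `*` (f2 @^-1` C))) => //.
  rewrite product_measure1E//; [|by rewrite -[X in measurable X]setTI; auto..].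
  rewrite s1// s2// muleACA [LHS]muleA -!EFinM mulVf ?mul1e//.
  by rewrite gt_eqF// mulr_gt0.
transitivity ((c1 * c2)%:E * ((c1 * c2)^-1%:E * m A)).
  by rewrite muleA -EFinM mulfV ?mul1e// gt_eqF// mulr_gt0.
by congr (_ * _); exact: esym.
Qed.

(** Cavalieri's principle, aimed at shears: points move only inside the fibres over the first
    coordinate, where a shear acts by translation. *)
Lemma product_measure_fibered (f : T1 * T2 -> T1 * T2) :
  measurable_fun setT f ->
  (forall x, (f x).1 = x.1) ->
  (forall x C, measurable C -> m2 [set y | C (f (x, y)).2] = m2 C) ->
  scales (m1 \x m2) f 1%R.
Proof.
move=> mf f1 f2 A mA; rewrite mul1e.
pose m := measure_function_pushforward__canonical__measure_function_Measure
  (m1 \x m2) mf.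
apply/esym; apply: (@product_measure_unique _ _ _ _ _ m1 m2 m) => // B C mB mC.
rewrite /m/= /pushforward /product_measure1/=.
transitivity (\int[m1]_x ((\1_B x)%:E * m2 C)).
  apply: eq_integral => x _ /=.
  rewrite indicE; have [xB|xB] := boolP (x \in B).
    rewrite mul1e -(f2 x _ mC); congr (m2 _); apply/seteqP; split => y /=.
      by move/xsectionP => /= [].
    move=> yC; apply/xsectionP; split => //=; rewrite f1; exact: set_mem.
  rewrite mul0e (_ : xsection _ _ = set0) ?measure0//.
  apply/seteqP; split => y //= /xsectionP/= [+ _].
  by rewrite f1/= => Bx; rewrite mem_set in xB.
rewrite ge0_integralZr//.
  by rewrite integral_indic// setIT.
by apply/measurable_EFinP; exact: measurable_indic.
Qed.

Lemma product_measure_fibered2 (f : T1 * T2 -> T1 * T2) :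
  measurable_fun setT f ->
  (forall x, (f x).2 = x.2) ->
  (forall y C, measurable C -> m1 [set x | C (f (x, y)).1] = m1 C) ->
  scales (m1 \x m2) f 1%R.
Proof.
move=> mf f1 f2 A mA; rewrite mul1e.
pose m := measure_function_pushforward__canonical__measure_function_Measure
  (m1 \x m2) mf.
apply/esym; apply: (@product_measure_unique _ _ _ _ _ m1 m2 m) => // B C mB mC.
rewrite /m/= /pushforward.
have mD : measurable (f @^-1` (B `*` C)).
  by rewrite -[X in measurable X]setTI; exact: (mf measurableT _ (measurableX
      mB mC)).
(* The product is rewritten with the other order of integration, so that sections over the second
   coordinate appear. *)
rewrite (@product_measure_unique _ _ _ _ _ m1 m2 (m1 \x^ m2))//; last first.
  exact: product_measure2E.
rewrite /product_measure2/=.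
transitivity (\int[m2]_y (m1 B * (\1_C y)%:E)).
  apply: eq_integral => y _ /=.
  rewrite indicE; have [yC|yC] := boolP (y \in C).
    rewrite mule1 -(f2 y _ mB); congr (m1 _); apply/seteqP; split => x /=.
      by move/ysectionP => /= [].
    move=> xB; apply/ysectionP; split => //=; rewrite f1; exact: set_mem.
  rewrite mule0 (_ : ysection _ _ = set0) ?measure0//.
  apply/seteqP; split => x //= /ysectionP/= [_ +].
  by rewrite f1/= => Cy; rewrite mem_set in yC.
rewrite ge0_integralZl//.
  by rewrite integral_indic// setIT.
by apply/measurable_EFinP; exact: measurable_indic.
Qed.

End product_scaling.

(** * Dilations and rotations of the plane *)

Section plane.
Variable R : realType.
Local Notation plane := (measurableTypeR R * measurableTypeR R)%type.

(** Multiplication by [c + i s] in real coordinates: a rotation when [c ^+ 2 + s ^+ 2 = 1], a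
    dilation when [s = 0] and [c > 0]. *)
Definition plane_mul (c s : R) (p : plane) : plane :=
  (c * p.1 - s * p.2 : R, s * p.1 + c * p.2 : R).

Lemma measurable_plane_mul c s : measurable_fun setT (plane_mul c s).
Proof.
have m1 : measurable_fun setT (fun p : plane =>
    p.1 : R) by exact: measurable_fst.
have m2 : measurable_fun setT (fun p : plane =>
    p.2 : R) by exact: measurable_snd.
by apply/measurable_fun_pair; [apply: measurable_funB|apply: measurable_funD];
  exact: measurable_funM.
Qed.

Lemma scales_plane_dilation (r : R) : 0 < r ->
  scales (@plane_measure R) (plane_mul r 0) (r^-1 * r^-1).
Proof.
move=> r0.
have mr : measurable_fun setT (fun x : measurableTypeR R =>
    r * x : measurableTypeR R).
  exact: measurable_funM.
have rV : 0 < r^-1 by rewrite invr_gt0.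
have sr A : measurable A -> lebesgue_measure ((fun x => r * x) @^-1` A) =
    (r^-1%:E * lebesgue_measure A)%E by exact: lebesgue_measureMl.
have <- : (fun p : plane => (r * p.1 : R, r * p.2 : R) : plane) = plane_mul r 0.
  by apply/funext => -[x y]; rewrite /plane_mul/= !mul0r subr0 add0r.
by move=> A mA; exact: (product_measure_scales mr mr rV rV sr sr mA).
Qed.

Let shear1 (b : R) : scales (@plane_measure R)
  (fun p : plane => (p.1 + b * p.2 : R, p.2) : plane) 1.
Proof.
have m1 : measurable_fun setT (fun p : plane =>
    p.1 : R) by exact: measurable_fst.
have m2 : measurable_fun setT (fun p : plane =>
    p.2 : R) by exact: measurable_snd.
apply: product_measure_fibered2 => //.
  apply/measurable_fun_pair => //=; apply: measurable_funD => //.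
  exact: measurable_funM.
by move=> y C mC; exact: (lebesgue_measureDr (b * y) mC).
Qed.

Let shear2 (a : R) : scales (@plane_measure R)
  (fun p : plane => (p.1, p.2 + a * p.1 : R) : plane) 1.
Proof.
have m1 : measurable_fun setT (fun p : plane =>
    p.1 : R) by exact: measurable_fst.
have m2 : measurable_fun setT (fun p : plane =>
    p.2 : R) by exact: measurable_snd.
apply: product_measure_fibered => //.
  apply/measurable_fun_pair => //=; apply: measurable_funD => //.
  exact: measurable_funM.
by move=> y C mC; exact: (lebesgue_measureDr (a * y) mC).
Qed.

(* For [c != -1] the rotation is a product of three shears, with
   [a = s / (1 + c) = tan (theta / 2)]. *)
Lemma scales_plane_rotation (c s : R) : c ^+ 2 + s ^+ 2 = 1 ->
  scales (@plane_measure R) (plane_mul c s) 1.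
Proof.
(* At the half-turn the shear factor [s / (1 + c)] would have denominator 0; there the map is a sign
   change in each coordinate. *)
move=> cs; have [c1|c1] := eqVneq c (-1).
  have s0 : s = 0.
    by apply/eqP; rewrite -sqrf_eq0; apply/eqP; move: cs; rewrite c1; lra.
  have mN : measurable_fun setT (fun x : measurableTypeR R =>
      - x : measurableTypeR R).
    exact: measurable_funN.
  have sN A : measurable A -> lebesgue_measure ((fun x : R => - x) @^-1` A) =
      (1%:E * lebesgue_measure A)%E.
    by move=> mA; rewrite mul1e; exact: lebesgue_measureN.
  have <- : (fun p : plane => (- p.1 : R, - p.2 : R) : plane) = plane_mul c s.
    apply/funext => -[x y]; rewrite /plane_mul/= c1 s0 !mul0r subr0 add0r.
    by rewrite !mulN1r.
  rewrite -[X in scales _ _ X]mulr1 => A mA.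
  exact: (product_measure_scales mN mN ltr01 ltr01 sN sN mA).
have c10 : 1 + c != 0 by rewrite addrC addr_eq0.
pose a := s / (1 + c).
have mp : measurable_fun setT (fun p : plane =>
    (p.1, p.2 + a * p.1 : R) : plane).
  apply/measurable_fun_pair => //=; apply: measurable_funD => //.
  exact: measurable_funM.
have mq : measurable_fun setT (fun p : plane =>
    (p.1 + (- s) * p.2 : R, p.2) : plane).
  apply/measurable_fun_pair => //=; apply: measurable_funD => //.
  exact: measurable_funM.
have := scales_comp mp (measurableT_comp mp mq) (shear2 a)
  (scales_comp mq mp (shear1 (- s)) (shear2 a)).
rewrite !mulr1; set f := _ \o _; suff -> : f = plane_mul c s by [].
have s2 : s ^+ 2 = (1 - c) * (1 + c) by move: cs; lra.
have as1 : a * s = 1 - c by rewrite /a mulrAC -expr2 s2 mulfK.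
have ac : a * c = s - a by rewrite /a; field.
rewrite /f; apply/funext => -[x y]; rewrite /plane_mul/=; congr pair.
  have -> : x + - s * (y + a * x) = x * (1 - a * s) - s * y by ring.
  by rewrite as1; ring.
have -> : y + a * x + a * (x + - s * (y + a * x)) =
  y * (1 - a * s) + x * (2 * a - a * (a * s)) by ring.
have ac1 : a * (1 - c) = a - (s - a) by rewrite -ac; ring.
rewrite as1 ac1; ring.
Qed.

End plane.

Section tuples.
Local Open Scope ereal_scope.
Context d (T : measurableType d) (R : realType).
Variable mu : {sigma_finite_measure set T -> \bar R}.

Lemma measurable_map_tuple n (f : T -> T) : measurable_fun setT f ->
  measurable_fun setT (fun t : n.-tuple T => map_tuple f t).
Proof.
move=> mf; apply/measurable_fun_tnthP => i.
rewrite (_ : _ \o _ = f \o (@tnth n T ^~ i)); last first.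
  by apply/funext => t; rewrite /= tnth_map.
by apply: measurableT_comp => //; exact: measurable_tnth.
Qed.

Lemma scales_tuple_measure n (f : T -> T) (c : R) : measurable_fun setT f ->
  (0 < c)%R -> scales mu f c ->
  scales (tuple_measure mu n) (fun t => map_tuple f t) (c ^+ n)%R.
Proof.
move=> mf c0 sf; elim: n => [|n IH] A mA.
  rewrite expr0 mul1e (_ : _ @^-1` A = A)//; apply/funext => t.
  by rewrite /preimage /mkset (tuple0 t) (tuple0 (map_tuple f _)).
pose tc (p : T * n.-tuple T) : n.+1.-tuple T := [tuple of p.1 :: p.2].
have mtc : measurable_fun setT tc by exact: measurable_cons.
have mA' : measurable (tc @^-1` A).
  by rewrite -[X in measurable X]setTI; exact: mtc.
have mm : measurable_fun setT (fun t : n.-tuple T => map_tuple f t).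
  exact: measurable_map_tuple.
have cn : (0 < c ^+ n)%R by rewrite exprn_gt0.
have := product_measure_scales mf mm c0 cn sf IH mA'.
rewrite -exprS => <-; congr ((mu \x tuple_measure mu n) _).
apply/funext => p; have E : map_tuple f (tc p) = tc (f p.1, map_tuple f p.2).
  exact: val_inj.
by rewrite /preimage /mkset -/(tc p) -E.
Qed.

(** Yields positivity of [dV] on nonempty open sets, which contain a box, and finiteness on the
    ball, which lies in one. *)
Lemma tuple_measure_box n (A : 'I_n -> set T) :
  (forall i, measurable (A i)) ->
  tuple_measure mu n [set t | forall i, A i (tnth t i)] = \prod_(i < n) mu (A
      i).
Proof.
elim: n A => [|n IH] A mA.
  by rewrite big_ord0 /= diracE mem_set// => -[].
pose B := [set t : n.-tuple T | forall i, A (lift ord0 i) (tnth t i)].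
have mB : measurable B.
  rewrite (_ : B = \bigcap_(i in [set: 'I_n]) ((@tnth n T ^~ i) @^-1` A (lift
      ord0 i))).
    apply: fin_bigcap_measurable => // i _.
    rewrite -[X in measurable X]setTI; exact: measurable_tnth.
  by apply/seteqP; split => t /= H i; [move=> _|]; exact: H.
rewrite big_ord_recl -IH// -product_measure1E//.
congr ((mu \x tuple_measure mu n) _).
apply/seteqP; split => -[x t] /=.
  move=> H; split => /=; first exact: (H ord0).
  by move=> i; have := H (lift ord0 i); rewrite tnthS.
by move=> [/= Ax Bt] i; case: (unliftP ord0 i) => [j ->|->//]; rewrite tnthS.
Qed.
End tuples.

(** * Topology and measurability in C^n *)

Section complex_lemmas.
Variable R : realType.
Implicit Types x y : R[i].

Lemma normr_normc x : `|x| = (normc x)%:C%C.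
Proof. by []. Qed.

Lemma normc_ge0 x : 0 <= normc x.
Proof. by case: x => a b; exact: sqrtr_ge0. Qed.

Lemma sqr_normc_ReIm x : normc x ^+ 2 = complex.Re x ^+ 2 + complex.Im x ^+ 2.
Proof. by case: x => a b /=; rewrite sqr_sqrtr// addr_ge0// sqr_ge0. Qed.

Lemma normc_le_ReIm x : normc x <= `|complex.Re x| + `|complex.Im x|.
Proof.
rewrite -(@ler_pXn2r _ 2)// ?nnegrE ?normc_ge0 ?addr_ge0//.
rewrite sqr_normc_ReIm sqrrD !real_normK ?num_real// addrAC lerDl.
by rewrite mulrn_wge0// mulr_ge0.
Qed.

Lemma normr_Re_le x : `|complex.Re x| <= normc x.
Proof.
rewrite -(@ler_pXn2r _ 2)// ?nnegrE ?normc_ge0//.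
by rewrite sqr_normc_ReIm real_normK ?num_real// lerDl sqr_ge0.
Qed.

Lemma normr_Im_le x : `|complex.Im x| <= normc x.
Proof.
rewrite -(@ler_pXn2r _ 2)// ?nnegrE ?normc_ge0//.
by rewrite sqr_normc_ReIm real_normK ?num_real// lerDr sqr_ge0.
Qed.

Lemma normcD x y : normc (x + y) <= normc x + normc y.
Proof. exact: le_normcD. Qed.

Lemma mulc_conj x : x * x^*%C = (normc x ^+ 2)%:C%C.
Proof.
rewrite sqr_normc_ReIm; case: x => a b; rewrite /=; simpc.
by congr (_ +i* _)%C; ring.
Qed.

(** The norm of [R[i]] takes its values in [R[i]], where [0 < e] forces [e] to be real; this is the
    bridge to epsilons in [R]. *)
Lemma normr_lt_real x (e : R[i]) : 0 < e -> (`|x| < e) = (normc x < complex.Re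
    e).
Proof.
case: e => a b; rewrite ltcE/= => /andP[/eqP -> _].
by rewrite ltcE/= eqxx.
Qed.

Lemma realc_gt0 (e : R) : (0 < e%:C%C :> R[i]) = (0 < e).
Proof. by rewrite ltcE/= eqxx. Qed.

Lemma cReM x y :
  complex.Re (x * y) = complex.Re x * complex.Re y - complex.Im x * complex.Im
      y.
Proof. by case: x y => [a b] [c d]. Qed.

Lemma cImM x y :
  complex.Im (x * y) = complex.Re x * complex.Im y + complex.Im x * complex.Re
      y.
Proof. by case: x y => [a b] [c d]. Qed.

Lemma cReD x y : complex.Re (x + y) = complex.Re x + complex.Re y.
Proof. by case: x y => [a b] [c d]. Qed.

Lemma cImD x y : complex.Im (x + y) = complex.Im x + complex.Im y.
Proof. by case: x y => [a b] [c d]. Qed.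

Lemma cReN x : complex.Re (- x) = - complex.Re x.
Proof. by case: x. Qed.

Lemma cImN x : complex.Im (- x) = - complex.Im x.
Proof. by case: x. Qed.

End complex_lemmas.

Section complex_space_topology.
Variables (R : realType) (n : nat).
Local Notation Cn := 'rV[R[i]]_n.

Lemma nbhs_CnP (z : Cn) (A : set Cn) : nbhs z A <->
  exists2 e : R, 0 < e & forall w : Cn, (forall j, normc (w 0 j - z 0 j) < e)
      -> A w.
Proof.
rewrite nbhs_ballP; split => [[e /= e0 eA]|[e e0 eA]].
  exists (complex.Re e); first by move: e0; rewrite ltcE => /andP[].
  move=> w wz; apply: eA; split=> // i j; rewrite (ord1 i).
  by rewrite /ball/= distrC normr_lt_real.
exists (e%:C%C) => /=; first by rewrite realc_gt0.
move=> w [_ wz]; apply: eA => j.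
by have := wz 0 j; rewrite /ball/= distrC normr_lt_real ?realc_gt0.
Qed.

Lemma continuous_CnP (f : Cn -> R[i]) (z : Cn) : {for z, continuous f} ->
  forall e : R, 0 < e -> exists2 d : R, 0 < d &
  forall w : Cn, (forall j, normc (w 0 j - z 0 j) < d) -> normc (f w - f z) < e.
Proof.
move=> cf e e0; have /cvgrPdist_lt/(_ e%:C%C) := cf.
rewrite realc_gt0 => /(_ e0)/nbhs_CnP[d d0 H]; exists d => // w /H.
by rewrite /= distrC normr_lt_real ?realc_gt0.
Qed.

Definition sqnorm (z : Cn) : R := \sum_j normc (z 0 j) ^+ 2.

Lemma cdotzz (z : Cn) : cdot z z = (sqnorm z)%:C%C.
Proof.
rewrite /cdot /sqnorm rmorph_sum/=; apply: eq_bigr => j _.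
exact: mulc_conj.
Qed.

Lemma sqnorm_ge0 z : 0 <= sqnorm z.
Proof. by apply: sumr_ge0 => j _; exact: sqr_ge0. Qed.

Lemma unit_ballE : @unit_ball R n = [set z | sqnorm z < 1].
Proof.
apply/seteqP; split=> z; rewrite /unit_ball/= cdotzz/= => h.
  rewrite -(sqr_sqrtr (sqnorm_ge0 z)) expr_lt1//; exact: sqrtr_ge0.
by rewrite -sqrtr1 ltr_sqrt.
Qed.

Lemma sqnormZ (a : R[i]) z : sqnorm (a *: z) = normc a ^+ 2 * sqnorm z.
Proof.
rewrite /sqnorm mulr_sumr; apply: eq_bigr => j _.
by rewrite mxE ComplexField.Normc.normcM exprMn.
Qed.

Lemma sqnorm0 : sqnorm 0 = 0.
Proof.
rewrite /sqnorm big1// => j _.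
by rewrite mxE ComplexField.Normc.normc0 expr0n.
Qed.

Lemma unit_ball0 : @unit_ball R n 0.
Proof. by rewrite unit_ballE/= sqnorm0. Qed.

Lemma unit_ballZ (a : R[i]) z : normc a <= 1 ->
  @unit_ball R n z -> unit_ball (a *: z).
Proof.
rewrite unit_ballE/= sqnormZ => a1; apply: le_lt_trans.
by rewrite ler_piMl ?sqnorm_ge0// expr_le1// normc_ge0.
Qed.

Lemma open_unit_ball : open (@unit_ball R n).
Proof.
rewrite openE => z; rewrite unit_ballE /= => z1; apply/nbhs_CnP.
(* For [e <= 1], [(|z_j| + e)^2 <= |z_j|^2 + e * (2 * |z_j| + 1)]; summing over [j] gives the excess
   [e * K]. *)
pose K := \sum_(j < n) (2 * normc (z 0 j) + 1).
have K0 : 0 <= K.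
  by apply: sumr_ge0 => j _; rewrite addr_ge0// mulr_ge0// normc_ge0.
exists (Num.min 1 ((1 - sqnorm z) / (K + 1))).
  by rewrite lt_min ltr01/= divr_gt0 ?subr_gt0// ltr_wpDl.
set e := Num.min _ _ => w wz /=.
have e1 : e <= 1 by rewrite ge_min lexx.
have e2 : e * (K + 1) <= 1 - sqnorm z.
  by rewrite -ler_pdivlMr ?ltr_wpDl// ge_min lexx orbT.
have [n0|n_gt0] := posnP n.
  rewrite /sqnorm big1 ?ltr01// => j _.
    by have := ltn_ord j; rewrite [X in (_ < X)%N]n0.
have e0 : 0 < e.
  by apply: le_lt_trans (wz (Ordinal n_gt0)); exact: normc_ge0.
have : sqnorm w <= sqnorm z + e * K.
  rewrite /sqnorm /K mulr_sumr -big_split/=; apply: ler_sum => j _.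
  have h1 : normc (w 0 j) <= normc (z 0 j) + e.
    rewrite -{1}(subrK (z 0 j) (w 0 j)); apply: le_trans (normcD _ _) _.
    by rewrite addrC lerD2l ltW.
  have h2 := normc_ge0 (z 0 j).
  have h3 : normc (w 0 j) ^+ 2 <= (normc (z 0 j) + e) ^+ 2.
    by rewrite ler_pXn2r// ?nnegrE ?normc_ge0// addr_ge0// ltW.
  apply: le_trans h3 _; rewrite sqrrD -addrA lerD2l.
  have : e ^+ 2 <= e by rewrite expr2 ler_piMl// ltW.
  lra.
lra.
Qed.

Local Notation plane := (measurableTypeR R * measurableTypeR R)%type.

Definition cunvec (z : Cn) : n.-tuple plane :=
  [tuple (complex.Re (z 0 j) : measurableTypeR R,
          complex.Im (z 0 j) : measurableTypeR R) | j < n].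

Lemma cunvecK : cancel cunvec (@cvec R n).
Proof.
by move=> z; apply/rowP => j; rewrite mxE tnth_mktuple/=; case: (z 0 j).
Qed.

Let box (x : {ffun 'I_n -> rat * rat} * nat) : set (n.-tuple plane) :=
  [set t | forall j,
    (ball (ratr (x.1 j).1 : R) (x.2.+1%:R^-1) `*`
     ball (ratr (x.1 j).2 : R) (x.2.+1%:R^-1)) (tnth t j)].

Lemma measurable_tuple_box (A : 'I_n -> set plane) :
  (forall j, measurable (A j)) ->
  measurable [set t : n.-tuple plane | forall j, A j (tnth t j)].
Proof.
move=> mA.
rewrite (_ : mkset _ =
    \bigcap_(j in [set: 'I_n]) ((@tnth n plane ^~ j) @^-1` A j)).
  apply: fin_bigcap_measurable => // j _.
  by rewrite -[X in measurable X]setTI; exact: measurable_tnth.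
by apply/seteqP; split => t /= H j; [move=> _|]; exact: H.
Qed.

Let measurable_box x : measurable (box x).
Proof.
apply: (@measurable_tuple_box (fun j =>
  ball (ratr (x.1 j).1 : R) (x.2.+1%:R^-1) `*`
  ball (ratr (x.1 j).2 : R) (x.2.+1%:R^-1))) => j.
by apply: measurableX; exact: measurable_ball.
Qed.

(** The sigma-algebra is transported from a product, so open sets are not measurable by definition.
    An open set corresponds to the union of the rational boxes inside it, and these are countably
    many. *)
Lemma open_measurable_Cn (U : set Cn) : open U -> measurable U.
Proof.
move=> oU.
pose F x := if pselect (box x `<=` @cvec R n @^-1` U) then box x else set0.
suff E : @cvec R n @^-1` U = \bigcup_x F x.
  rewrite /measurable/= E; apply: countable_bigcupT_measurable.
    exact: countableP.
  move=> x; rewrite /F; case: (pselect (box x `<=` @cvec R n @^-1` U)) => h.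
    exact: measurable_box.
  exact: measurable0.
apply/seteqP; split => [t Ut|t [x _]]; last first.
  by rewrite /F; case: pselect => // sub /sub.
move: oU; rewrite openE => /(_ _ Ut) /nbhs_CnP[e e0 He].
(* Two points of one box differ by less than [2 * r] in every real coordinate, hence by less than
   [4 * r] in the modulus of each complex coordinate. *)
have [k ke] : exists k, 4 * k.+1%:R^-1 < e :> R.
  exists (Num.Def.archi_bound (4 / e)).
  rewrite -[_^-1]div1r mulrA mulr1 ltr_pdivrMr// mulrC -ltr_pdivrMr//.
  apply: lt_le_trans (archi_boundP _) _; first by rewrite divr_ge0// ltW.
  by rewrite ler_nat.
pose r : R := k.+1%:R^-1.
have r0 : 0 < r by rewrite invr_gt0.
have approx (x : R) : {q : rat | ball (ratr q : R) r x}.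
  apply: cid; have [|q] := @rat_in_itvoo _ (x - r) (x + r); first lra.
  by rewrite in_itv/= => qI; exists q; rewrite /ball/= ltr_norml; lra.
pose q := [ffun j => (sval (approx (tnth t j).1), sval (approx (tnth t j).2))].
exists (q, k) => //; rewrite /F.
have tq : box (q, k) t.
  move=> j; rewrite ffunE; split; first exact: (proj2_sig (approx (tnth t
      j).1)).
  exact: (proj2_sig (approx (tnth t j).2)).
case: pselect => // sub; exfalso; apply: sub => t' t'q; apply: He => j.
have [] := tq j; have [] := t'q j; rewrite /ball/= -/r !ltr_norml =>
    h1 h2 h3 h4.
apply: le_lt_trans (normc_le_ReIm _) _; rewrite !mxE /=.
apply: lt_le_trans (ltW ke); rewrite -/r.
have : `|(tnth t' j).1 - (tnth t j).1| < 2 * r by rewrite ltr_norml; lra.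
have : `|(tnth t' j).2 - (tnth t j).2| < 2 * r by rewrite ltr_norml; lra.
lra.
Qed.

Lemma dV_open_gt0 (U : set Cn) : open U -> U !=set0 -> (0 < dV U)%E.
Proof.
move=> oU [z Uz].
move: (oU); rewrite openE => /(_ _ Uz) /nbhs_CnP[e e0 He].
have [t tz] : exists t, cvec t = z by exists (cunvec z); exact: cunvecK.
pose A j : set plane := ball ((tnth t j).1 : R) (e / 2) `*`
                        ball ((tnth t j).2 : R) (e / 2).
have mA j : measurable (A j) by apply: measurableX; exact: measurable_ball.
have e20 : 0 < e / 2 by lra.
apply: (@lt_le_trans _ _ (tuple_measure (@plane_measure R) n
    [set t : n.-tuple plane | forall j, A j (tnth t j)])).
  rewrite tuple_measure_box//; elim/big_ind: _ => // [|j _];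
      first exact: mule_gt0.
  rewrite [X in (0 < X)%E]product_measure1E; try exact: measurable_ball.
  by apply: mule_gt0;
    rewrite [X in (0 < X)%E](lebesgue_measure_ball _ (ltW e20)) lte_fin
        mulrn_wgt0.
apply: le_measure; rewrite ?inE.
- exact: measurable_tuple_box.
- exact: (open_measurable_Cn oU).
move=> t' t'A /=; apply: He => j; rewrite -tz.
have [] := t'A j; rewrite /ball/= => h1 h2.
apply: le_lt_trans (normc_le_ReIm _) _; rewrite !mxE /= distrC.
rewrite [X in _ + X]distrC; lra.
Qed.

Lemma dV_ball_lty : (dV (@unit_ball R n) < +oo)%E.
Proof.
have mB := open_measurable_Cn open_unit_ball.
pose A (j : 'I_n) : set plane := ball (0 : R) 2 `*` ball (0 : R) 2.
have mA j : measurable (A j) by apply: measurableX; exact: measurable_ball.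
apply: (@le_lt_trans _ _ (tuple_measure (@plane_measure R) n
    [set t : n.-tuple plane | forall j, A j (tnth t j)])).
  apply: (@le_measure _ _ _ (tuple_measure (@plane_measure R) n)
    (@cvec R n @^-1` @unit_ball R n)); rewrite ?inE.
  - exact: mB.
  - exact: (measurable_tuple_box mA).
  move=> t; rewrite /preimage unit_ballE /= => tB j.
  have hj : normc (cvec t 0 j) < 2.
    apply: (@le_lt_trans _ _ 1); last lra.
    rewrite -(@ler_pXn2r _ 2)// ?nnegrE ?normc_ge0// expr1n.
    apply: le_trans (ltW tB); rewrite /sqnorm (bigD1 j)//= lerDl.
    by apply: sumr_ge0 => i _; exact: sqr_ge0.
  have := normr_Re_le (cvec t 0 j); have := normr_Im_le (cvec t 0 j).
  rewrite !mxE/= in hj * => h1 h2.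
  by split; rewrite /ball/= sub0r normrN; lra.
rewrite tuple_measure_box//.
rewrite (eq_bigr (fun=> (16 : R)%:E)); last first.
  move=> j _; rewrite [LHS]product_measure1E; try exact: measurable_ball.
  have b2 : lebesgue_measure (ball (0 : R) 2) = 4%:E.
    by rewrite lebesgue_measure_ball// -mulr_natl; congr EFin; ring.
  by rewrite [X in (X * _)%E]b2 [X in (_ * X)%E]b2 -EFinM; congr EFin; ring.
by rewrite -(big_morph EFin (@EFinM _) (erefl _)) ltry.
Qed.

End complex_space_topology.

(** * Invariance of dV and circular averages *)

Section dV_invariance.
Variables (R : realType) (n : nat).
Local Notation Cn := 'rV[R[i]]_n.
Local Notation dV := (@dV R n).
Local Notation plane := (measurableTypeR R * measurableTypeR R)%type.
Local Notation cunvec := (@cunvec R n).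

Lemma cvecK : cancel (@cvec R n) cunvec.
Proof.
move=> t; apply: eq_from_tnth => j; rewrite tnth_mktuple mxE/=.
by case: (tnth t j).
Qed.

Lemma measurable_cunvec : measurable_fun setT cunvec.
Proof.
move=> _ A mA; rewrite setTI /measurable/= -comp_preimage.
by rewrite (_ : _ \o _ = id) ?preimage_id//; apply/funext => t; exact: cvecK.
Qed.

Lemma cvec_plane_mul (c s : R) (t : n.-tuple plane) :
  cvec (map_tuple (plane_mul c s) t) = (c +i* s)%C *: cvec t.
Proof.
apply/rowP => j; rewrite !mxE tnth_map /plane_mul/=.
by rewrite [s * _ + _]addrC.
Qed.

Lemma scales_dV (c s k : R) : 0 < k ->
  scales (@plane_measure R) (plane_mul c s) k ->
  scales dV (fun z => (c +i* s)%C *: z) (k ^+ n).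
Proof.
move=> k0 sk A mA.
have <- := scales_tuple_measure (n := n) (measurable_plane_mul c s) k0 sk mA.
congr (tuple_measure (@plane_measure R) n _); apply/funext => t.
by rewrite /preimage /mkset cvec_plane_mul.
Qed.

Lemma dV_rotation (a : R[i]) : normc a = 1 -> scales dV (fun z => a *: z) 1.
Proof.
case: a => c s cs.
have : (c ^+ 2 + s ^+ 2) = 1.
  by have := sqr_normc_ReIm (c +i* s)%C; rewrite cs expr1n.
move=> /scales_plane_rotation/(scales_dV ltr01).
by rewrite expr1n.
Qed.

(** Dilation by the inverse of [Num.sqrt t] pulls the ball back to this set. Each complex coordinate
    contributes two real factors [Num.sqrt t], that is [t]. *)
Lemma dV_sqnorm_lt (t : R) : 0 < t ->
  dV [set z | sqnorm z < t] = ((t ^+ n)%:E * dV (@unit_ball R n))%E.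
Proof.
move=> t0; have st0 : 0 < Num.sqrt t by rewrite sqrtr_gt0.
have r0 : 0 < (Num.sqrt t)^-1 by rewrite invr_gt0.
have k0 : 0 < (Num.sqrt t)^-1^-1 * (Num.sqrt t)^-1^-1.
  by rewrite mulr_gt0// invr_gt0.
have := scales_dV k0 (scales_plane_dilation r0)
  (open_measurable_Cn (@open_unit_ball R n)).
rewrite invrK -expr2 sqr_sqrtr ?ltW// => <-; congr (dV _).
by apply/seteqP; split => z; rewrite unit_ballE /= sqnormZ/= expr0n/= addr0
    sqrtr_sqr ger0_norm ?ltW// exprVn sqr_sqrtr ?ltW// ltr_pdivrMl// mulr1.
Qed.

(** Joint measurability in the angle and the point, as Fubini requires. *)
Lemma measurable_scale_circle : measurable_fun setT
  (fun p : measurableTypeR R * Cn => (cos p.1 +i* sin p.1)%C *: p.2).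
Proof.
rewrite (_ : (fun _ => _) = (@cvec R n) \o
    (fun p => map_tuple (plane_mul (cos p.1) (sin p.1)) (cunvec p.2)));
        last first.
  by apply/funext => p; rewrite /= cvec_plane_mul cunvecK.
apply: measurableT_comp; first exact: measurable_cvec.
apply/measurable_fun_tnthP => j.
rewrite (_ : _ \o _ = fun p : measurableTypeR R * Cn =>
    plane_mul (cos p.1) (sin p.1) (tnth (cunvec p.2) j)); last first.
  by apply/funext => p; rewrite /= tnth_map.
have mc : measurable_fun setT (fun p : measurableTypeR R * Cn => cos p.1 : R).
  apply: measurableT_comp; last exact: measurable_fst.
  by apply: continuous_measurable_fun; exact: continuous_cos.
have ms : measurable_fun setT (fun p : measurableTypeR R * Cn => sin p.1 : R).
  apply: measurableT_comp; last exact: measurable_fst.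
  by apply: continuous_measurable_fun; exact: continuous_sin.
have mt : measurable_fun setT
    (fun p : measurableTypeR R * Cn => tnth (cunvec p.2) j).
  apply: (measurableT_comp (f := @tnth n plane ^~ j)).
    exact: measurable_tnth.
  apply: measurableT_comp; first exact: measurable_cunvec.
  exact: measurable_snd.
have m1 : measurable_fun setT
    (fun p : measurableTypeR R * Cn => (tnth (cunvec p.2) j).1 : R).
  by apply: measurableT_comp mt; exact: measurable_fst.
have m2 : measurable_fun setT
    (fun p : measurableTypeR R * Cn => (tnth (cunvec p.2) j).2 : R).
  by apply: measurableT_comp mt; exact: measurable_snd.
apply/measurable_fun_pair; [apply: measurable_funB|apply: measurable_funD];
  exact: measurable_funM.
Qed.

Lemma measurable_sqnorm : measurable_fun setT (@sqnorm R n).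
Proof.
rewrite (_ : @sqnorm R n = (fun t : n.-tuple plane =>
    \sum_(j <- index_enum 'I_n) ((tnth t j).1 ^+ 2 + (tnth t j).2 ^+ 2 : R)) \o
        cunvec); last first.
  apply/funext => z /=; apply: eq_bigr => j _.
  by rewrite tnth_mktuple sqr_normc_ReIm.
apply: measurableT_comp; last exact: measurable_cunvec.
apply: measurable_sum => j; apply: measurable_funD; apply: measurable_funX.
  apply: (measurableT_comp (f := fst)); first exact: measurable_fst.
  exact: measurable_tnth.
apply: (measurableT_comp (f := snd)); first exact: measurable_snd.
exact: measurable_tnth.
Qed.

Lemma measurable_unit_ball : measurable (@unit_ball R n).
Proof. exact: open_measurable_Cn (@open_unit_ball R n). Qed.

Lemma measurable_fun_extended_ball (g : Cn -> R) :
  (forall a, open (@unit_ball R n `&` [set z | a < g z])) ->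
  (forall z, ~ unit_ball z -> g z = 0) ->
  measurable_fun setT g.
Proof.
move=> og g0; apply: (measurability _ (RGenOInfty.measurableE R)) => //.
move=> /= _ [_ [a ->] <-]; rewrite setTI.
rewrite (_ : _ @^-1` _ = (@unit_ball R n `&` [set z | a < g z]) `|`
    (if a < 0 then ~` @unit_ball R n else set0)).
  apply: measurableU; first exact: open_measurable_Cn.
  by case: ifP => _ //; exact: measurableC measurable_unit_ball.
apply/seteqP; split => z /=; rewrite in_itv/= andbT.
  move=> az; have [zB|zB] := pselect (unit_ball z); first by left.
  by right; move: az; rewrite g0// => ->.
move=> [[]//|]; case: ifPn => // a0 zB; by rewrite g0.
Qed.

Lemma dV_sigma_finite : sigma_finite setT dV.
Proof.
exists (fun k => [set z : Cn | sqnorm z < k.+1%:R]).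
  apply/esym/seteqP; split => // z _ /=; exists (Num.Def.archi_bound (sqnorm
      z)) => //=.
  apply: lt_le_trans (archi_boundP (sqnorm_ge0 z)) _.
  by rewrite ler_nat.
move=> k; split.
  have := measurable_sqnorm measurableT (measurable_itv `]-oo, k.+1%:R[).
  by rewrite setTI set_itvE.
rewrite dV_sqnorm_lt// lte_mul_pinfty ?lee_fin ?exprn_ge0//.
exact: dV_ball_lty.
Qed.

End dV_invariance.

HB.instance Definition _ (R : realType) (n : nat) :=
  Measure_isSigmaFinite.Build _ _ _ (@dV R n) (@dV_sigma_finite R n).

Section circular_averages.
Variables (R : realType) (n : nat).
Local Notation Cn := 'rV[R[i]]_n.
Local Notation dV := (@dV R n).
Local Notation mu := (@lebesgue_measure R).

Local Notation circle t z := ((cos t +i* sin t)%C *: z).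

Lemma normc_circle (t : R) : normc (cos t +i* sin t)%C = 1.
Proof. by rewrite /= cos2Dsin2 sqrtr1. Qed.

Let measurable_circle (t : R) : measurable_fun setT (fun z : Cn => circle t z).
Proof.
apply: (measurableT_comp (@measurable_scale_circle R n) (g := fun z : Cn =>
    (t, z))).
exact: measurable_pair1.
Qed.

Let dV_circle t A : measurable A -> dV ((fun z : Cn =>
    circle t z) @^-1` A) = dV A.
Proof.
by move=> mA; rewrite (dV_rotation (normc_circle t) mA) mul1e.
Qed.

Lemma ge0_integral_dV_circle t (h : Cn -> \bar R) :
  measurable_fun setT h -> (forall z, 0 <= h z)%E ->
  (\int[dV]_z h (circle t z) = \int[dV]_z h z)%E.
Proof.
move=> mh h0.
have := @ge0_integral_pushforward _ _ _ _ _ _ (measurable_circle t) dV setT h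
  measurableT mh (fun z _ => h0 z).
rewrite preimage_setT => <-; apply: eq_measure_integral => A mA _.
exact: dV_circle.
Qed.

Lemma integral_dV_circle t (h : Cn -> R) :
  measurable_fun setT h -> dV.-integrable setT (EFin \o h) ->
  (\int[dV]_z (h (circle t z))%:E = \int[dV]_z (h z)%:E)%E.
Proof.
move=> mh ih.
have mh' : measurable_fun setT (EFin \o h) by exact/measurable_EFinP.
have ih' : dV.-integrable ((fun z : Cn => circle t z) @^-1` setT)
    ((EFin \o h) \o (fun z : Cn => circle t z)).
  apply/integrableP; split.
    by apply: measurableT_comp => //; exact: measurable_circle.
  rewrite preimage_setT /=.
  rewrite (ge0_integral_dV_circle t (h := fun z => `|(h z)%:E|%E))//.
    by have /integrableP[] := ih.
  exact: measurableT_comp.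
have := integral_pushforward (measurable_circle t) mh' ih' measurableT.
rewrite preimage_setT => <-; apply: eq_measure_integral => A mA _.
exact: dV_circle.
Qed.

Lemma integral_circular_average (g : Cn -> R) :
  measurable_fun setT g -> dV.-integrable setT (EFin \o g) ->
  (forall z, ~ unit_ball z -> g z = 0) ->
  (forall z, unit_ball z ->
    \int[mu]_(t in `[0%R, (2 * pi)%R]) (g (circle t z))%:E = (2 * pi * g
        0)%:E)%E ->
  (\int[dV]_z (g z)%:E = (g 0)%:E * dV (@unit_ball R n))%E.
Proof.
move=> mg ig g0 avg.
pose I : set (measurableTypeR R) := `[0%R, 2 * pi]%classic.
have mI : measurable I by exact: measurable_itv.
have pi2 : 0 < 2 * pi :> R by rewrite mulr_gt0// pi_gt0.
have muI : mu I = (2 * pi)%:E.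
  by rewrite /I lebesgue_measure_itv/= lte_fin pi2 oppr0 adde0.
have mulI (F : measurableTypeR R -> \bar R) :
    (\int[mu]_t (F t * (\1_I t)%:E) = \int[mu]_(t in I) F t)%E.
  by rewrite [RHS]integral_mkcond epatch_indic.
(* The restriction of the angle enters as an indicator factor, so that Fubini and rotation
   invariance both apply on whole spaces. *)
pose H (p : measurableTypeR R * Cn) : \bar R :=
  ((g (circle p.1 p.2))%:E * (\1_I p.1)%:E)%E.
have mH : measurable_fun setT H.
  apply: emeasurable_funM; apply/measurable_EFinP.
    by apply: measurableT_comp => //; exact: measurable_scale_circle.
  apply: measurableT_comp; first exact: measurable_indic.
  exact: measurable_fst.
have mg' : measurable_fun setT (EFin \o g) by exact/measurable_EFinP.
(* By rotation invariance the inner integral of [|H|] does not depend on the angle within [I], so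
   the total is [2 * pi] times the integral of [|g|]. *)
have iH : (mu \x dV)%E.-integrable setT H.
  apply/integrable12ltyP => //.
  under eq_integral => t _.
    under eq_integral => z _ do rewrite /H abseM/= [`|\1_I t|]ger0_norm//.
    rewrite ge0_integralZr//; last first.
      apply/measurable_EFinP; apply: measurableT_comp => //.
      by apply: measurableT_comp => //; exact: measurable_circle.
    rewrite (ge0_integral_dV_circle t (h := fun z => `|g z|%:E))//; last first.
      by apply/measurable_EFinP; exact: measurableT_comp.
    over.
  rewrite /= mulI integral_cst// [X in (_ * X < _)%E]muI muleC lte_mul_pinfty//.
    by rewrite lee_fin ltW.
  by have /integrableP[] := ig.
have [J JE] : exists J, J = (\int[dV]_z (g z)%:E)%E by eexists.
have E1 t : (\int[dV]_z H (t, z) = J * (\1_I t)%:E)%E.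
  rewrite JE -(integral_dV_circle t mg ig) -integralZr//.
  apply/integrableP; split.
    by apply: (measurableT_comp mg'); exact: measurable_circle.
  rewrite (ge0_integral_dV_circle t (h := fun z => `|g z|%:E))//.
    by have /integrableP[] := ig.
  by apply/measurable_EFinP; exact: measurableT_comp.
have E2 z : (\int[mu]_t H (t, z) = (2 * pi * g 0)%:E *
    (\1_(@unit_ball R n) z)%:E)%E.
  rewrite mulI indicE; have [zB|zB] := boolP (z \in _).
    by rewrite mule1 avg//; exact: set_mem.
  (* Rotations preserve [sqnorm], so the circle through a point off the ball stays off the ball. *)
  rewrite mule0; apply: integral0_eq => t _; rewrite /= g0//.
  rewrite unit_ballE/= sqnormZ normc_circle expr1n mul1r => zB1.
  by move: zB; rewrite unit_ballE mem_set.
have := Fubini iH.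
rewrite (eq_integral _ _ (fun t _ => E1 t)) (eq_integral _ _ (fun z _ => E2 z)).
rewrite mulI integral_cst// -JE.
have -> : (\int[dV]_z ((2 * pi * g 0)%:E * (\1_(@unit_ball R n) z)%:E) =
    (2 * pi * g 0)%:E * dV (@unit_ball R n))%E.
  rewrite integralZl//.
    by rewrite integral_indic ?setIT//; exact: measurable_unit_ball.
  apply/integrableP; split.
    by apply/measurable_EFinP; apply: measurable_indic;
        exact: measurable_unit_ball.
  under eq_integral => z _ do rewrite /= ger0_norm//.
  rewrite integral_indic ?setIT//; last exact: measurable_unit_ball.
  exact: dV_ball_lty.
have muI' : (J * mu I = J * (2 * pi)%:E)%E by congr (_ * _)%E.
move=> E; have := etrans (esym muI') E; rewrite [in RHS]EFinM muleC -muleA.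
move/(congr1 (fun x => (2 * pi)^-1%:E * x)%E).
by rewrite !muleA -EFinM mulVf ?gt_eqF// !mul1e JE.
Qed.
End circular_averages.

(** * Circle means of holomorphic functions *)

Section circle_mean.
Variable R : realType.
Local Notation mu := (@lebesgue_measure R).

Lemma is_derive_first_order (f : R -> R) (k : R) : is_derive (0 : R) 1 f k ->
  forall e, 0 < e -> exists2 d, 0 < d & forall t, `|t| < d ->
    `|f t - f 0 - k * t| <= e * `|t|.
Proof.
move=> [df dk] e e0; rewrite /derive in dk.
have : (fun h : R => h^-1 *: (f (h *: 1 + 0) - f 0)) @ 0^' --> k.
  by rewrite -dk; exact: df.
move=> /cvgrPdist_le/(_ e e0)/nbhs_ballP[d /= d0 H]; exists d => // t td.
have [->|t0] := eqVneq t 0.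
  by rewrite subrr mulr0 subr0 normr0 mulr0.
have := H t; rewrite /ball/= sub0r normrN => /(_ td t0).
rewrite /GRing.scale/= mulr1 addr0 => Ht.
have -> : f t - f 0 - k * t = - (k - t^-1 * (f t - f 0)) * t.
  by rewrite opprB mulrBl mulrAC mulVf// mul1r.
by rewrite normrM normrN ler_wpM2r.
Qed.

(** The complex exponential of [x + i y]: [x] is the logarithm of the modulus, so [x <= 0] covers
    the closed unit disc without its centre. *)
Definition cis_exp (x y : R) : R[i] := ((expR x * cos y) +i* (expR x * sin
    y))%C.

Lemma cis_expD x y x' y' : cis_exp (x + x') (y + y') = cis_exp x y * cis_exp x'
    y'.
Proof.
by rewrite /cis_exp; simpc; rewrite expRD cosD sinD; congr (_ +i* _)%C; ring.
Qed.

Lemma normc_cis_exp x y : normc (cis_exp x y) = expR x.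
Proof.
by rewrite /= !exprMn -mulrDr cos2Dsin2 mulr1 sqrtr_sqr ger0_norm// expR_ge0.
Qed.

Lemma cis_exp_first_order0 (e : R) : 0 < e -> exists2 d, 0 < d &
  forall x y, `|x| < d -> `|y| < d ->
    normc (cis_exp x y - 1 - (x +i* y)%C) <= e * (`|x| + `|y|).
Proof.
move=> e0.
have [e1 e10 [e11 e1e]] : exists2 e1 : R, 0 < e1 & e1 <= 1 /\ 8 * e1 <= e.
  (* The error terms below add up to at most [e1 * |x| + 7 * e1 * |y|]; 8 is a round bound. *)
  exists (Num.min 1 (e / 8)); first by rewrite lt_min ltr01 divr_gt0.
  split; first by rewrite ge_min lexx.
  by rewrite mulrC -ler_pdivlMr// ge_min lexx orbT.
have [d1 d10 H1] := is_derive_first_order (is_derive_expR 0) e10.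
have [d2 d20 H2] := is_derive_first_order (is_derive_cos 0) e10.
have [d3 d30 H3] := is_derive_first_order (is_derive_sin 0) e10.
exists (Num.min (Num.min d1 d2) (Num.min d3 e1)).
  by rewrite !lt_min d10 d20 d30 e10.
move=> x y; rewrite !lt_min => /andP[/andP[x1 _] /andP[_ xe]].
move=> /andP[/andP[_ y2] /andP[y3 ye]].
have {}H1 := H1 _ x1; have {}H2 := H2 _ y2; have {}H3 := H3 _ y3.
rewrite expR0 mul1r in H1; rewrite sin0 cos0 oppr0 mul0r subr0 in H2.
rewrite sin0 cos0 mul1r subr0 in H3.
have c1 := cos_max y.
have x0 := normr_ge0 x; have y0 := normr_ge0 y.
have E1 : `|expR x - 1| <= 2 * `|x|.
  have := ler_normD (expR x - 1 - x) x; rewrite subrK; nra.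
have S1 : `|sin y| <= 2 * `|y|.
  have := ler_normD (sin y - y) y; rewrite subrK; nra.
apply: le_trans (normc_le_ReIm _) _ => /=.
have -> : expR x * cos y - 1 - x =
  (expR x - 1 - x) * cos y + (1 + x) * (cos y - 1) by ring.
have -> : expR x * sin y - 0 - y = (expR x - 1) * sin y + (sin y - y) by ring.
have R1 : `|(expR x - 1 - x) * cos y| <= e1 * `|x|.
  by rewrite normrM; apply: le_trans (ler_piMr _ c1) _.
have R2 : `|(1 + x) * (cos y - 1)| <= 2 * (e1 * `|y|).
  rewrite normrM ler_pM//; apply: le_trans (ler_normD _ _) _.
  by rewrite normr1; lra.
have R3 : `|(expR x - 1) * sin y| <= (2 * `|x|) * (2 * `|y|).
  by rewrite normrM ler_pM.
have R4 : `|x| * `|y| <= e1 * `|y| by rewrite ler_wpM2r// ltW.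
have := ler_normD ((expR x - 1 - x) * cos y) ((1 + x) * (cos y - 1)).
have := ler_normD ((expR x - 1) * sin y) (sin y - y).
have : 8 * e1 * (`|x| + `|y|) <= e * (`|x| + `|y|) by rewrite ler_wpM2r//
    addr_ge0.
have := mulr_ge0 (ltW e10) x0; have := mulr_ge0 (ltW e10) y0; lra.
Qed.

Definition cdifferentiable_at (F : R[i] -> R[i]) (l : R[i]) : Prop :=
  exists D, forall e : R, 0 < e -> exists2 d : R, 0 < d &
    forall l', normc (l' - l) < d ->
      normc (F l' - F l - D * (l' - l)) <= e * normc (l' - l).

(** Chain rule for [F] after the exponential, with derivative [D * cis_exp x y]. That [E] is a
    single complex factor carries the Cauchy-Riemann equations. *)
Lemma cis_exp_first_order (F : R[i] -> R[i]) x y :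
  cdifferentiable_at F (cis_exp x y) ->
  exists E : R[i], forall e : R, 0 < e -> exists2 d, 0 < d &
    forall x' y', `|x' - x| < d -> `|y' - y| < d ->
      normc (F (cis_exp x' y') - F (cis_exp x y)
             - E * ((x' - x) +i* (y' - y))%C) <= e * (`|x' - x| + `|y' - y|).
Proof.
move=> [D HD]; exists (D * cis_exp x y) => e e0.
pose c0 := expR x; have c00 : 0 < c0 := expR_gt0 x.
pose nD := normc D; have nD0 : 0 <= nD := normc_ge0 D.
(* The error splits into two halves: [e1] for [F] along an increment of size at most [2 * c0 * S],
   and [e2] for the exponential, multiplied by [|D| * c0]. *)
have [e1 e10 e1e] : exists2 e1 : R, 0 < e1 & 2 * c0 * e1 <= e / 2.
  exists (e / 2 / (2 * c0)); first by rewrite !divr_gt0// mulr_gt0.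
  by rewrite mulrC divfK// mulf_neq0// gt_eqF.
have [e2 e20 [e21 e2e]] : exists2 e2 : R, 0 < e2 & e2 <= 1
    /\ nD * c0 * e2 <= e / 2.
  exists (Num.min 1 (e / 2 / (nD * c0 + 1))).
    by rewrite lt_min ltr01 !divr_gt0// ltr_wpDl// mulr_ge0// ltW.
  split; first by rewrite ge_min lexx.
  have k0 : 0 <= nD * c0 by rewrite mulr_ge0// ltW.
  apply: (@le_trans _ _ ((nD * c0 + 1) * (e / 2 / (nD * c0 + 1)))).
    apply: ler_pM => //; rewrite ?le_min ?ler01 ?ge_min ?lexx ?orbT ?lerDl//=.
    by rewrite !divr_ge0// ?ltW// ltr_wpDl.
  by rewrite mulrC divfK// gt_eqF// ltr_wpDl.
have [d1 d10 H1] := HD _ e10.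
have [d2 d20 H2] := cis_exp_first_order0 e20.
exists (Num.min d2 (d1 / (4 * c0))).
  by rewrite lt_min d20 divr_gt0// mulr_gt0.
move=> x' y'; rewrite !lt_min !ltr_pdivlMr ?mulr_gt0// =>
    /andP[x2 xd] /andP[y2 yd].
have := H2 _ _ x2 y2.
set dx := x' - x in x2 xd *; set dy := y' - y in y2 yd *.
set q := (dx +i* dy)%C; set p := cis_exp dx dy => Hp.
have cE : cis_exp x' y' = cis_exp x y * p.
  by rewrite -cis_expD /dx /dy addrCA subrr addr0 addrCA subrr addr0.
set S := `|dx| + `|dy| in Hp *.
have S0 : 0 <= S by rewrite addr_ge0.
have qS : normc q <= S by exact: normc_le_ReIm.
have pS : normc (p - 1) <= 2 * S.
  have := normcD (p - 1 - q) q; rewrite subrK.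
  have : e2 * S <= S by rewrite ler_piMl.
  lra.
have cS : normc (cis_exp x' y' - cis_exp x y) <= 2 * c0 * S.
  rewrite cE -{2}(mulr1 (cis_exp x y)) -mulrBr ComplexField.Normc.normcM
      normc_cis_exp.
  by rewrite -/c0 (mulrC 2) -mulrA ler_pM2l.
have cd : normc (cis_exp x' y' - cis_exp x y) < d1.
  apply: le_lt_trans cS _; rewrite /S; lra.
have {}H1 := H1 _ cd.
have -> : F (cis_exp x' y') - F (cis_exp x y) - D * cis_exp x y * q =
   (F (cis_exp x' y') - F (cis_exp x y) - D * (cis_exp x' y' - cis_exp x y)) +
   D * cis_exp x y * (p - 1 - q) by rewrite cE; ring.
apply: le_trans (normcD _ _) _.
rewrite !ComplexField.Normc.normcM normc_cis_exp -/c0 -/nD.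
have h1 : e1 * normc (cis_exp x' y' - cis_exp x y) <= e / 2 * S.
  apply: (@le_trans _ _ (e1 * (2 * c0 * S))); first by rewrite ler_pM2l.
  by rewrite mulrA ler_wpM2r// mulrC.
have h2 : nD * c0 * normc (p - 1 - q) <= e / 2 * S.
  apply: (@le_trans _ _ (nD * c0 * (e2 * S))).
    by rewrite ler_wpM2l// mulr_ge0// ltW.
  by rewrite mulrA ler_wpM2r.
lra.
Qed.

Section holomorphic_disc.
Variable F : R[i] -> R[i].
Hypothesis dF : forall l, normc l <= 1 -> cdifferentiable_at F l.

Let U x y := complex.Re (F (cis_exp x y)).
Let V x y := complex.Im (F (cis_exp x y)).

(** With [G = U + i V], the two forms are [- Re (G dz)] and [Im (G dz)], closed by Cauchy-Riemann.
    They are arranged so that the coefficient of [dy], integrated along a vertical side, is the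
    imaginary or the real part of a circle mean. *)
Let closedUV x y : x <= 0 ->
  closed_form_at (fun x y => - U x y) V x y /\ closed_form_at V U x y.
Proof.
move=> x0; have [|E H] := @cis_exp_first_order F x y.
  by apply: dF; rewrite normc_cis_exp -expR0 ler_expR.
split.
  exists (- complex.Re E), (complex.Im E), (complex.Re E) => e e0.
  have [d d0 {}H] := H _ e0; exists d => // x' y' xd yd.
  have {}H := H _ _ xd yd; split.
    apply: le_trans H; apply: le_trans (normr_Re_le _); rewrite -normrN.
    rewrite !(cReD, cReN, cReM)/= /U le_eqVlt; apply/orP; left; apply/eqP.
    by congr (`| _ |); ring.
  apply: le_trans H; apply: le_trans (normr_Im_le _).
  rewrite !(cImD, cImN, cImM)/= /V le_eqVlt; apply/orP; left; apply/eqP.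
  by congr (`| _ |); ring.
exists (complex.Im E), (complex.Re E), (- complex.Im E) => e e0.
have [d d0 {}H] := H _ e0; exists d => // x' y' xd yd.
have {}H := H _ _ xd yd; split.
  apply: le_trans H; apply: le_trans (normr_Im_le _).
  rewrite !(cImD, cImN, cImM)/= /V le_eqVlt; apply/orP; left; apply/eqP.
  by congr (`| _ |); ring.
apply: le_trans H; apply: le_trans (normr_Re_le _).
by rewrite !(cReD, cReN, cReM)/= /U mulNr.
Qed.

Let periodic x : F (cis_exp x (2 * pi)) = F (cis_exp x 0).
Proof. by rewrite /cis_exp mulr_natl cos2pi sin2pi cos0 sin0. Qed.

(** The horizontal sides cancel by periodicity, so the integral of [Q] over a period is the same on
    the unit circle, [x = 0], and on the circle of radius [expR a]. *)
Let rect_eq (P Q : R -> R -> R) a : a <= 0 ->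
  (forall x y, x <= 0 -> closed_form_at P Q x y) ->
  (forall x, P x (2 * pi) = P x 0) ->
  \int[mu]_(y in `[0, 2 * pi]) Q 0 y = \int[mu]_(y in `[0, 2 * pi]) Q a y.
Proof.
move=> a0 H Pper; have pi2 : 0 <= 2 * pi :> R by rewrite mulr_ge0// pi_ge0.
have := @rect_circulation_eq0 R P Q a 0 0 (2 * pi) _ a0 pi2.
rewrite /rect_circulation RintegralB//; last 2 first.
- apply: continuous_segment_integrable => y _.
  by have [] := closed_form_at_continuous (H 0 y (lexx _)).
- apply: continuous_segment_integrable => y _.
  by have [] := closed_form_at_continuous (H a y a0).
have -> : \int[mu]_(x in `[a, 0]) (P x (2 * pi) - P x 0) = 0.
  rewrite -[RHS](mul0r (fine (mu `[a, 0]))) -Rintegral_cst//.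
  by apply: eq_Rintegral => x _; rewrite Pper subrr.
rewrite subr0 => E.
by apply/eqP; rewrite -subr_eq0; apply/eqP/E => x y /andP[_ x0] _; exact: H.
Qed.

(** The exponential never takes the value 0, so the centre is approached through circles of small
    radius [expR a]. *)
Let near0 e : 0 < e -> exists2 a, a <= 0 &
  forall y, normc (F (cis_exp a y) - F 0) <= e.
Proof.
move=> e0; have [|D H] := @dF 0; first by rewrite ComplexField.Normc.normc0.
have [d d0 {}H] := H _ ltr01.
(* [r <= 1] makes [ln r <= 0]; the last entry bounds [|D| * r + r], which dominates the increment of
   [F], by [e]. *)
pose r := Num.min (d / 2) (Num.min 1 (e / (normc D + 1))).
have D0 := normc_ge0 D.
have r0 : 0 < r by rewrite !lt_min ltr01 !divr_gt0// ltr_wpDl.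
exists (ln r).
  by rewrite -ln1 ler_ln// ?posrE// /r ge_min ge_min lexx orbT.
move=> y; have cr : normc (cis_exp (ln r) y) = r by rewrite normc_cis_exp lnK.
have rd : r < d by rewrite /r gt_min; apply/orP; left; lra.
have re : r * (normc D + 1) <= e.
  by rewrite -ler_pdivlMr ?ltr_wpDl// /r !ge_min lexx !orbT.
have := H (cis_exp (ln r) y); rewrite subr0 cr => /(_ rd).
set w := F _ - F 0 => h.
rewrite -(subrK (D * cis_exp (ln r) y) w); apply: le_trans (normcD _ _) _.
rewrite ComplexField.Normc.normcM cr; lra.
Qed.

(** The integral does not depend on the radius, and by [near0] it is within any [e] of [2 * pi * k]
    for a small radius. *)
Let mean_of (P Q : R -> R -> R) k :
  (forall x y, x <= 0 -> closed_form_at P Q x y) ->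
  (forall x, P x (2 * pi) = P x 0) ->
  (forall x y, `|Q x y - k| <= normc (F (cis_exp x y) - F 0)) ->
  (\int[mu]_(y in `[0%R, (2 * pi)%R]) (Q 0%R y)%:E = (2 * pi * k)%:E)%E.
Proof.
move=> H Pper Qk; have pi2 : 0 <= 2 * pi :> R by rewrite mulr_ge0// pi_ge0.
have iQ a : a <= 0 -> mu.-integrable `[0, 2 * pi] (EFin \o Q a).
  move=> a0; apply: continuous_segment_integrable => y _.
  by have [] := closed_form_at_continuous (H a y a0).
rewrite -(fineK (integrable_fin_num _ (iQ _ (lexx _))))//; congr EFin.
apply/eqP; rewrite -subr_eq0 -normr_le0; apply/ler_addgt0Pr => e e0.
have e1 : 0 < e / (2 * pi) by rewrite divr_gt0// mulr_gt0// pi_gt0.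
have [a a0 Ha] := near0 e1.
have := @Rintegral_segment_near R (Q a) 0 (2 * pi) k (e / (2 * pi)) pi2 (iQ _
    a0).
rewrite subr0 -(rect_eq a0 H Pper) divfK ?gt_eqF ?mulr_gt0 ?pi_gt0//.
rewrite add0r (mulrC k); apply => y _.
exact: le_trans (Qk _ _) (Ha _).
Qed.

Lemma circle_mean_Re :
  (\int[mu]_(t in `[0%R, (2 * pi)%R]) (complex.Re (F (cos t +i* sin t)%C))%:E =
   (2 * pi * complex.Re (F 0))%:E)%E.
Proof.
have <- := @mean_of V U (complex.Re (F 0)).
- by apply: eq_integral => t _; rewrite /U /cis_exp expR0 !mul1r.
- by move=> x y x0; have [] := closedUV y x0.
- by move=> x; rewrite /V periodic.
- by move=> x y; rewrite /U -cReN -cReD; exact: normr_Re_le.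
Qed.

Lemma circle_mean_Im :
  (\int[mu]_(t in `[0%R, (2 * pi)%R]) (complex.Im (F (cos t +i* sin t)%C))%:E =
   (2 * pi * complex.Im (F 0))%:E)%E.
Proof.
have <- := @mean_of (fun x y => - U x y) V (complex.Im (F 0)).
- by apply: eq_integral => t _; rewrite /V /cis_exp expR0 !mul1r.
- by move=> x y x0; have [] := closedUV y x0.
- by move=> x; rewrite /U periodic.
- by move=> x y; rewrite /V -cImN -cImD; exact: normr_Im_le.
Qed.

End holomorphic_disc.
End circle_mean.

(** * The mean value property on the ball *)

Section mean_value.
Variables (R : realType) (n : nat).
Local Notation Cn := 'rV[R[i]]_n.
Local Notation dV := (@dV R n).
Local Notation B := (@unit_ball R n).
Local Notation mB := (@measurable_unit_ball R n).
Implicit Types f g h : Cn -> R[i].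

Lemma ball_holomorphic_continuous f z : ball_holomorphic f -> B z ->
  {for z, continuous f}.
Proof. by move=> hf /hf; exact: differentiable_continuous. Qed.

(** The derivative of the slice is the directional derivative of [f] along [z]. As [z] lies in the
    open ball, the slice is differentiable on the closed disc, boundary included, as rectangles
    ending at [x = 0] require. *)
Lemma ball_holomorphic_line f z (l : R[i]) : ball_holomorphic f -> B z ->
  normc l <= 1 -> cdifferentiable_at (fun l => f (l *: z)) l.
Proof.
move=> hf zB l1; have lzB := unit_ballZ l1 zB.
have /cvg_ex[/= D HD] : derivable f (l *: z) z by exact: diff_derivable (hf _
    lzB).
exists D => e e0.
have e0' : 0 < e%:C%C :> R[i] by rewrite realc_gt0.
move: HD => /cvgrPdist_le/(_ _ e0')/nbhs_ballP[d /= d0 H].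
exists (complex.Re d); first by move: d0; rewrite ltcE => /andP[].
move=> l' l'd; have [->|l'l] := eqVneq l' l.
  by rewrite !subrr mulr0 subr0 ComplexField.Normc.normc0 mulr0.
have hl0 : l' - l != 0 by rewrite subr_eq0.
have := H (l' - l); rewrite /ball/= sub0r normrN normr_lt_real// =>
    /(_ l'd hl0).
rewrite -scalerDl subrK normr_normc lecR => Hl.
rewrite [X in normc X](_ : _ = - (D - (l' - l)^-1 *: (f (l' *: z) - f (l *:
    z))) * (l' - l)).
  rewrite ComplexField.Normc.normcM ler_wpM2r ?normc_ge0//.
  by rewrite normcN; exact: Hl.
rewrite opprB mulrBl; congr (_ - _).
by rewrite /GRing.scale/= mulrAC mulVf// mul1r.
Qed.

Lemma measurable_ball_holomorphic f : ball_holomorphic f ->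
  (forall z, ~ B z -> f z = 0) ->
  measurable_fun setT (fun z => complex.Re (f z)) /\
  measurable_fun setT (fun z => complex.Im (f z)).
Proof.
move=> hf f0.
have key (r : R[i] -> R) : r 0 = 0 -> (forall x y, `|r x - r y| <= normc (x -
    y)) ->
    measurable_fun setT (fun z => r (f z)).
  move=> r0 rL; apply: measurable_fun_extended_ball => [a|z zB]; last first.
    by rewrite f0.
  rewrite openE => z [zB /= az].
  have cf := ball_holomorphic_continuous hf zB.
  have e0 : 0 < r (f z) - a by rewrite subr_gt0.
  have [d d0 H] := continuous_CnP cf e0.
  apply: filterI; first by move: (@open_unit_ball R n); rewrite openE; exact.
  apply/nbhs_CnP; exists d => // w /H h /=.
  by have := rL (f z) (f w); rewrite -(normcN (f z - _)) opprB ler_norml; lra.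
split; apply: key => // x y.
  by rewrite -cReN -cReD; exact: normr_Re_le.
by rewrite -cImN -cImD; exact: normr_Im_le.
Qed.

Definition cintegrable h : Prop :=
  dV.-integrable B (fun z => (complex.Re (h z))%:E) /\
  dV.-integrable B (fun z => (complex.Im (h z))%:E).

Lemma eq_cintegral f g : (forall z, B z -> f z = g z) ->
  cintegral B f = cintegral B g.
Proof.
by move=> fg; rewrite /cintegral; congr (_ +i* _)%C; apply: eq_Rintegral => z;
  rewrite inE => /fg ->.
Qed.

Lemma cintegralZ (c : R[i]) h : cintegrable h ->
  cintegral B (fun z => c * h z) = c * cintegral B h.
Proof.
move=> [hr hi]; rewrite /cintegral; case: c => a b; simpc.
have Z (k : R) (p : Cn -> R) : dV.-integrable B (EFin \o p) ->
    dV.-integrable B (EFin \o (fun z => k * p z)).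
  by move=> ip; apply: (integrableZl mB k ip).
have mB' := mB; congr (_ +i* _)%C.
  transitivity (\int[dV]_(z in B) (a * complex.Re (h z) - b * complex.Im (h
      z))).
    by apply: eq_Rintegral => z _; rewrite cReM.
  by rewrite RintegralB ?RintegralZl//; exact: Z.
transitivity (\int[dV]_(z in B) (a * complex.Im (h z) + b * complex.Re (h z))).
  by apply: eq_Rintegral => z _; rewrite cImM.
by rewrite RintegralD ?RintegralZl//; exact: Z.
Qed.

Lemma cintegral_conj h : cintegrable h ->
  cintegral B (fun z => (h z)^*%C) = (cintegral B h)^*%C.
Proof.
move=> [_ hi]; have mB' := mB; rewrite /cintegral/=; congr (_ +i* _)%C.
  by apply: eq_Rintegral => z _; case: (h z).
rewrite -mulN1r -RintegralZl//.
by apply: eq_Rintegral => z _; rewrite mulN1r; case: (h z).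
Qed.

Lemma dV_ball_fin_num : dV B \is a fin_num.
Proof. by rewrite ge0_fin_numE//; exact: dV_ball_lty. Qed.

Lemma dV_ball_gt0 : 0 < fine (dV B).
Proof.
apply: fine_gt0; rewrite dV_ball_lty andbT.
by apply: dV_open_gt0; [exact: open_unit_ball|exists 0; exact: unit_ball0].
Qed.

Lemma integrable_ball_cst (c : R) : dV.-integrable B (EFin \o cst c).
Proof.
apply/integrableP; split; first exact/measurable_EFinP/measurable_cst.
rewrite /= integral_cst//; last exact: mB.
by rewrite lte_mul_pinfty//; exact: dV_ball_lty.
Qed.

Lemma A2_measurable f : A2 f ->
  measurable_fun setT (fun z => complex.Re (f z)) /\
  measurable_fun setT (fun z => complex.Im (f z)).
Proof. by move=> [hf _ f0]; exact: measurable_ball_holomorphic. Qed.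

Lemma A2_integrable_sqr f : A2 f ->
  dV.-integrable B (fun z => (normc (f z) ^+ 2)%:E).
Proof.
move=> Af; have [mr mi] := A2_measurable Af; have [_ fi _] := Af.
apply/integrableP; split.
  apply/measurable_EFinP; apply: measurable_funTS.
  rewrite (_ : (fun _ => _) = fun z => complex.Re (f z) ^+ 2 + complex.Im (f z)
      ^+ 2).
    by apply: measurable_funD; apply: measurable_funX.
  by apply/funext => z; rewrite sqr_normc_ReIm.
apply: le_lt_trans fi; rewrite le_eqVlt; apply/orP; left; apply/eqP.
by apply: eq_integral => z _; rewrite /= ger0_norm// sqr_ge0.
Qed.

(** The ball has finite volume, so square integrability gives integrability through
    [|f| <= 1 + |f|^2]. *)
Lemma A2_cintegrable f : A2 f -> cintegrable f.
Proof.
move=> Af; have [mr mi] := A2_measurable Af.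
have i2 : dV.-integrable B (fun z => (1 + normc (f z) ^+ 2)%:E).
  have := integrableD mB (integrable_ball_cst 1) (A2_integrable_sqr Af).
  exact.
have key (p : Cn -> R) : measurable_fun setT p ->
    (forall z, `|p z| <= normc (f z)) -> dV.-integrable B (fun z => (p z)%:E).
  move=> mp pf; apply: (le_integrable mB _ _ i2).
    by apply/measurable_EFinP; exact: measurable_funTS.
  move=> z _ /=; rewrite lee_fin; apply: le_trans (pf z) _.
  rewrite ger0_norm ?addr_ge0 ?sqr_ge0//.
  have := sqr_ge0 (normc (f z) - 1); have := normc_ge0 (f z).
  rewrite sqrrB expr1n; lra.
by split; apply: key => // z; [exact: normr_Re_le|exact: normr_Im_le].
Qed.

Lemma A2_mean f : A2 f -> cintegral B f = f 0 * (fine (dV B))%:C%C.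
Proof.
move=> Af; have [mr mi] := A2_measurable Af; have [ir ii] := A2_cintegrable Af.
have [hf _ f0] := Af.
have key (p : Cn -> R) : measurable_fun setT p ->
    dV.-integrable B (EFin \o p) -> (forall z, ~ B z -> p z = 0) ->
    (forall z, B z -> \int[lebesgue_measure]_(t in `[0%R, (2 * pi)%R])
       (p ((cos t +i* sin t)%C *: z))%:E = (2 * pi * p 0)%:E)%E ->
    \int[dV]_(z in B) p z = p 0 * fine (dV B).
  move=> mp ip p0 avg.
  have pB : (EFin \o p) \_ B = EFin \o p.
    by apply/funext => z; rewrite patchE; case: ifPn => // /negP;
        rewrite inE => /p0/= ->.
  rewrite /Rintegral integral_mkcond pB.
  rewrite (integral_circular_average mp)//; last first.
    by rewrite -pB; apply/(integrable_mkcond _ mB).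
  by rewrite -(fineK dV_ball_fin_num) -EFinM.
rewrite /cintegral (key (fun z => complex.Re (f z)))//; last 2 first.
- by move=> z /f0 ->.
- move=> z zB; rewrite (circle_mean_Re (F := fun l => f (l *: z)))//.
    by rewrite scale0r.
  by move=> l; exact: ball_holomorphic_line.
rewrite (key (fun z => complex.Im (f z)))//; last 2 first.
- by move=> z /f0 ->.
- move=> z zB; rewrite (circle_mean_Im (F := fun l => f (l *: z)))//.
    by rewrite scale0r.
  by move=> l; exact: ball_holomorphic_line.
by case: (f 0) => a b; simpc.
Qed.

End mean_value.

(** * Constants in the Bergman space *)

(** Differentiability is local. This serves for [ball_cst], which agrees with a constant function
    near each point of the ball but in general not globally. *)
Lemma near_eq_differentiable (K : numFieldType) (V W : normedModType K)
    (f g : V -> W) (x : V) :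
  (\forall y \near x, f y = g y) -> differentiable g x -> differentiable f x.
Proof.
move=> fg dg; have [dc /eqaddoP Hg] := (diff_locallyP x g).1 dg.
have fgx : f x = g x by exact: nbhs_singleton fg.
have Hf : f \o shift x = cst (f x) + 'd g x +o_ 0 id.
  apply/eqaddoP => eps eps0; have := Hg _ eps0.
  have fg0 : \forall y \near 0, f (y + x) = g (y + x).
    by move: fg; rewrite (near_shift 0 x) /= subr0.
  by apply: filterS2 fg0 => y /= E; rewrite !fctE /= E fgx.
have df := diff_unique dc Hf.
by apply/diff_locallyP; rewrite df.
Qed.

Section constants.
Variables (R : realType) (n : nat).
Local Notation Cn := 'rV[R[i]]_n.
Local Notation dV := (@dV R n).
Local Notation B := (@unit_ball R n).
Local Notation mB := (@measurable_unit_ball R n).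
Local Notation vol := (fine (dV B)).
Implicit Types f g h : Cn -> R[i].

(** Constants as members of [A2]: they must vanish off the ball. *)
Definition ball_cst (c : R[i]) : Cn -> R[i] := patch (cst 0) B (cst c).

Lemma ball_cstT c z : B z -> ball_cst c z = c.
Proof. by move=> zB; rewrite /ball_cst patchT// inE. Qed.

Lemma ball_cst_notin c z : ~ B z -> ball_cst c z = 0.
Proof. by move=> zB; rewrite /ball_cst patchC// inE. Qed.

Lemma ball_cst0 c : ball_cst c 0 = c.
Proof. by apply: ball_cstT; exact: unit_ball0. Qed.

Lemma weighted_compE f : weighted_comp (cst 1) (cst 0) f = ball_cst (f 0).
Proof.
by apply/funext => z; rewrite /weighted_comp /ball_cst !patchE mul1r.
Qed.

Lemma A2_ball_cst c : A2 (ball_cst c).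
Proof.
split; last by move=> z; exact: ball_cst_notin.
  move=> z zB; apply: (near_eq_differentiable (g := cst c)) => //.
  have := @open_unit_ball R n; rewrite openE => /(_ z zB).
  by apply: filterS => w wB; exact: ball_cstT.
rewrite (eq_integral (fun=> (normc c ^+ 2)%:E)); last first.
  by move=> z; rewrite inE => zB; rewrite ball_cstT.
rewrite integral_cst//; last exact: mB.
by rewrite lte_mul_pinfty// ?dV_ball_lty// lee_fin sqr_ge0.
Qed.

(** The reproducing property at the origin, where the kernel is constant: by the mean value
    property, pairing with constants amounts to evaluation at 0. *)
Lemma A2dot_ball_cstl c g : A2 g -> A2dot (ball_cst c) g = c * (g 0)^*%C *
    vol%:C%C.
Proof.
move=> Ag; rewrite /A2dot.
rewrite (@eq_cintegral _ _ _ (fun z => c * (g z)^*%C)); last first.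
  by move=> z zB; rewrite ball_cstT.
rewrite cintegralZ; last first.
  have [ir ii] := A2_cintegrable Ag; split.
    by apply: eq_integrable ir => //; [exact: mB|move=> z _; case: (g z)].
  have := integrableZl mB (-1) ii.
  apply: eq_integrable => //; first exact: mB.
  by move=> z _ /=; rewrite mulN1e; case: (g z).
rewrite cintegral_conj; last exact: A2_cintegrable.
by rewrite A2_mean// [X in c * X]rmorphM mulrA; congr (_ * _);
    exact: conjc_real.
Qed.

Lemma A2dot_ball_cstr f c : A2 f -> A2dot f (ball_cst c) = f 0 * c^*%C *
    vol%:C%C.
Proof.
move=> Af; rewrite /A2dot.
rewrite (@eq_cintegral _ _ _ (fun z => c^*%C * f z)); last first.
  by move=> z zB; rewrite ball_cstT// mulrC.
rewrite cintegralZ; last exact: A2_cintegrable.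
by rewrite A2_mean// mulrA (mulrC c^*%C).
Qed.

Lemma Re_A2dot f : complex.Re (A2dot f f) = \int[dV]_(z in B) normc (f z) ^+ 2.
Proof.
by rewrite /A2dot/=; apply: eq_Rintegral => z _; rewrite mulc_conj.
Qed.

(** Pythagoras for the splitting of [f] into its mean and a remainder: once the square is expanded,
    the linear terms integrate by [A2_mean] to [- 2 * |f 0|^2 * vol]. *)
Lemma Rintegral_sqr_sub_mean f : A2 f ->
  \int[dV]_(z in B) normc (f z - f 0) ^+ 2 =
  complex.Re (A2dot f f) - normc (f 0) ^+ 2 * vol.
Proof.
move=> Af; rewrite Re_A2dot; have [ir ii] := A2_cintegrable Af.
have mB' := mB; have i2 := A2_integrable_sqr Af.
set a := complex.Re (f 0); set b := complex.Im (f 0).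
have Z (k : R) (p : Cn -> R) : dV.-integrable B (EFin \o p) ->
    dV.-integrable B (EFin \o (fun z => k * p z)).
  by move=> ip; apply: (integrableZl mB k ip).
have D (p q : Cn -> R) : dV.-integrable B (EFin \o p) ->
    dV.-integrable B (EFin \o q) -> dV.-integrable B (EFin \o (fun z =>
        p z + q z)).
  by move=> ip iq; apply: (integrableD mB ip iq).
have := A2_mean Af; rewrite /cintegral => /eqP.
rewrite eq_complex/= => /andP[/eqP + /eqP +].
rewrite cReM cImM/= !mulr0 subr0 add0r -/a -/b => hr hi.
transitivity (\int[dV]_(z in B) (normc (f z) ^+ 2 +
  ((- 2 * a) * complex.Re (f z) + ((- 2 * b) * complex.Im (f z) + normc (f 0)
      ^+ 2)))).
  apply: eq_Rintegral => z _; rewrite !sqr_normc_ReIm !(cReD, cReN, cImD, cImN).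
  by rewrite -/a -/b; ring.
have i4 := integrable_ball_cst n (normc (f 0) ^+ 2).
have i3 := D _ _ (Z (- 2 * b) _ ii) i4.
rewrite RintegralD//; last exact: D (Z (- 2 * a) _ ir) i3.
rewrite RintegralD//; last exact: Z.
rewrite RintegralD//; last exact: Z.
rewrite Rintegral_cst// (RintegralZl _ mB' ir) (RintegralZl _ mB' ii) hr hi
    sqr_normc_ReIm -/a -/b.
ring.
Qed.

Lemma A2_mean_le f : A2 f -> normc (f 0) ^+ 2 * vol <= complex.Re (A2dot f f).
Proof.
move=> Af; rewrite -subr_ge0 -Rintegral_sqr_sub_mean//.
by apply: Rintegral_ge0 => z _; exact: sqr_ge0.
Qed.

(** Equality forces [f = f 0] almost everywhere on the ball. A point of the ball where it fails
    would, by continuity, have a neighbourhood of such points, and nonempty open sets have positive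
    volume. *)
Lemma A2_mean_eq f : A2 f -> complex.Re (A2dot f f) = normc (f 0) ^+ 2 * vol ->
  f = ball_cst (f 0).
Proof.
move=> Af E; have [hf _ f0] := Af.
apply/funext => z; have [zB|zB] := pselect (B z); last first.
  by rewrite ball_cst_notin// f0.
rewrite ball_cstT//; apply: contrapT => /eqP; rewrite -subr_eq0 => fz.
have nfz : 0 < normc (f z - f 0).
  rewrite lt_neqAle normc_ge0 andbT eq_sym; apply/negP => /eqP.
  by move/ComplexField.Normc.eq0_normc => h; rewrite h eqxx in fz.
have := Rintegral_sqr_sub_mean Af; rewrite E subrr => I0.
pose p w := (normc (f w - f 0) ^+ 2)%:E.
have [mr mi] := A2_measurable Af.
have mp : measurable_fun B p.
  apply: measurable_funTS; apply/measurable_EFinP.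
  rewrite (_ : (fun _ => _) = fun w => (complex.Re (f w) - complex.Re (f 0)) ^+
      2 +
      (complex.Im (f w) - complex.Im (f 0)) ^+ 2).
    by apply: measurable_funD; apply: measurable_funX; apply: measurable_funB.
  by apply/funext => w; rewrite sqr_normc_ReIm !(cReD, cReN, cImD, cImN).
have ip : dV.-integrable B p.
  have i4 := integrable_ball_cst n (2 * normc (f 0) ^+ 2).
  have i3 := integrableD mB (integrableZl mB 2 (A2_integrable_sqr Af)) i4.
  apply: (le_integrable mB mp _ i3) => w _ /=.
  rewrite lee_fin ger0_norm ?sqr_ge0//.
  apply: le_trans (ler_norm _); have nD := normcD (f w) (- f 0).
  rewrite normcN in nD.
  have n0 := normc_ge0 (f w - f 0).
  apply: (@le_trans _ _ ((normc (f w) + normc (f 0)) ^+ 2)).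
    by rewrite ler_pXn2r// nnegrE addr_ge0// normc_ge0.
  have := sqr_ge0 (normc (f w) - normc (f 0)); rewrite sqrrB sqrrD; lra.
have ip0 : (\int[dV]_(w in B) `|p w| = 0)%E.
  rewrite (eq_integral p); last first.
    by move=> w _; rewrite /p gee0_abs// lee_fin sqr_ge0.
  rewrite -(fineK (integrable_fin_num mB ip)); congr EFin.
  exact: I0.
have [N [mN N0 sub]] := (ae_eq_integral_abs dV mB mp).1 ip0.
pose O := [set w | B w /\ 0 < normc (f w - f 0)].
have oO : open O.
  rewrite openE => w [wB w0]; apply: filterI.
    by have := @open_unit_ball R n; rewrite openE; exact.
  have [d d0 H] := continuous_CnP (ball_holomorphic_continuous hf wB) w0.
  apply/nbhs_CnP; exists d => // w' /H ww' /=.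
  have := normcD (f w - f w') (f w' - f 0).
  by rewrite addrA subrK -(normcN (f w - f w')) opprB; lra.
have := dV_open_gt0 oO; apply/not_implyP; split; first by exists z.
apply/negP; rewrite -leNgt -N0; apply: le_measure; rewrite ?inE//.
  exact: open_measurable_Cn.
move=> w [wB w0]; apply: sub => /= h; have := h wB.
by rewrite /p => -[] /eqP; rewrite sqrf_eq0 gt_eqF.
Qed.

End constants.

(** * Evaluation at the origin as an operator *)

Lemma bolzano_weierstrass_pair (R : realType) (u v : nat -> R) (M : R) :
  (forall k, `|u k| <= M) -> (forall k, `|v k| <= M) ->
  exists l : nat -> nat, {homo l : i j / (i < j)%N} /\
    exists a b : R, u \o l @ \oo --> a /\ v \o l @ \oo --> b.
Proof.
have bnd (w : nat -> R) : (forall k, `|w k| <= M) -> bounded_fun w.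
  by move=> wM; exists M; split; [exact: num_real|move=> N MN k _;
      apply: le_trans (ltW MN)].
move=> uM vM.
have [l1 i1 c1] := bolzano_weierstrass (bnd _ uM).
have [l2 i2 c2] := bolzano_weierstrass (bnd (v \o l1) (fun k => vM (l1 k))).
have lt1 : {homo l1 : i j / (i < j)%N} by move=> i j;
    rewrite !ltnNge -!leEnat i1.
have lt2 : {homo l2 : i j / (i < j)%N} by move=> i j;
    rewrite !ltnNge -!leEnat i2.
exists (l1 \o l2); split; first by move=> i j ij; apply/lt1/lt2.
exists (limn (u \o l1)), (limn ((v \o l1) \o l2)); split; last exact: c2.
have ge k : (k <= l2 k)%N.
  by elim: k => // k IH; apply: leq_ltn_trans IH _; exact: lt2.
have l2oo : l2 @ \oo --> \oo.
  by move=> A [N _ NA]; exists N => // k /= Nk; apply: NA => /=;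
      exact: leq_trans (ge k).
exact: (cvg_comp l2 (u \o l1) l2oo c1).
Qed.

Section projection.
Variables (R : realType) (n : nat).
Local Notation Cn := 'rV[R[i]]_n.
Local Notation dV := (@dV R n).
Local Notation B := (@unit_ball R n).
Local Notation vol := (fine (dV B)).
Local Notation H := (@A2 R n).
Local Notation ip := (@A2dot R n).
Local Notation P := (@weighted_comp R n (cst 1) (cst 0)).
Local Notation one := (@ball_cst R n 1).

Let PE f : P f = ball_cst (f 0). Proof. exact: weighted_compE. Qed.

Lemma ball_cstZ (a c : R[i]) : a *: ball_cst c = ball_cst (a * c) :> (Cn ->
    R[i]).
Proof.
apply/funext => z; rewrite -[LHS]/(a * ball_cst c z).
have [zB|zB] := pselect (B z); first by rewrite !ball_cstT.
by rewrite !ball_cst_notin// mulr0.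
Qed.

Lemma ball_cstD (a c : R[i]) : ball_cst a + ball_cst c = ball_cst (a + c) :>
    (Cn -> R[i]).
Proof.
apply/funext => z; rewrite !fctE.
have [zB|zB] := pselect (B z); first by rewrite !ball_cstT.
by rewrite !ball_cst_notin// addr0.
Qed.

Lemma linear_operator_eval0 : linear_operator H P.
Proof.
split=> [f _|a f g _ _]; rewrite !PE; first exact: A2_ball_cst.
by rewrite ball_cstZ ball_cstD.
Qed.

Lemma hnorm_ball_cst c : hnorm ip (ball_cst c) = normc c * Num.sqrt vol.
Proof.
rewrite /hnorm A2dot_ball_cstl; last exact: A2_ball_cst.
rewrite ball_cst0 mulc_conj -rmorphM/= sqrtrM ?sqr_ge0//.
by rewrite sqrtr_sqr ger0_norm// normc_ge0.
Qed.

Lemma normc_eval0_le f : H f -> normc (f 0) * Num.sqrt vol <= hnorm ip f.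
Proof.
move=> Hf; rewrite -hnorm_ball_cst /hnorm; apply: ler_wsqrtr.
apply: le_trans (A2_mean_le Hf).
rewrite A2dot_ball_cstl; last exact: A2_ball_cst.
by rewrite ball_cst0 mulc_conj -rmorphM.
Qed.

Lemma orthogonal_projection_eval0 : orthogonal_projection H ip P.
Proof.
split.
- split; first exact: linear_operator_eval0.
  by exists 1 => f Hf; rewrite mul1r PE hnorm_ball_cst; exact: normc_eval0_le.
- by move=> f _; rewrite !PE ball_cst0.
- split=> [f Hf|f g Hf Hg]; rewrite !PE; first exact: A2_ball_cst.
  by rewrite A2dot_ball_cstl// A2dot_ball_cstr.
Qed.

Lemma has_dim_line (E : set (Cn -> R[i])) :
  (forall f, E f <-> exists c, f = ball_cst c) -> has_dim E 1.
Proof.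
move=> EP; exists (fun=> one); split.
- by move=> _; apply/EP; exists 1.
- move=> c; rewrite big_ord1 => h i; rewrite (ord1 i).
  by move/(congr1 (fun f : Cn -> R[i] => f 0)): h;
      rewrite ball_cstZ ball_cst0 mulr1.
- move=> f /EP[c ->]; exists (fun=> c).
  by rewrite big_ord1 ball_cstZ mulr1.
Qed.

Lemma has_rank_eval0 : has_rank H P 1.
Proof.
apply: has_dim_line => f; split; first by move=> [g _ <-]; rewrite PE;
    exists (g 0).
by move=> [c ->]; exists (ball_cst c); [exact: A2_ball_cst|rewrite PE
    ball_cst0].
Qed.

(** [has_dim] only asserts that some basis of size [m] exists; uniqueness of [m] is what lets
    multiplicities be read off [is_singular_values]. *)
Lemma has_dim_line_uniq (E : set (Cn -> R[i])) m :
  (forall f, E f <-> exists c, f = ball_cst c) -> has_dim E m -> m = 1%N.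
Proof.
move=> EP [e [Ee free gen]].
have /gen[c cE] : E one by apply/EP; exists 1.
case: m e Ee free gen c cE => [|[|m]]// e Ee free gen c.
  rewrite big_ord0 => /(congr1 (fun f : Cn -> R[i] => f 0)).
  by rewrite ball_cst0 => /eqP; rewrite oner_eq0.
move=> _.
have [a aE] : exists a, forall i, e i = ball_cst (a i).
  have h i : exists a, e i = ball_cst a by apply/EP; exact: Ee.
  by exists (fun i => sval (cid (h i))) => i; case: cid.
pose i0 : 'I_m.+2 := ord0; pose i1 : 'I_m.+2 := lift ord0 ord0.
(* The relation [a i1 * e i0 - a i0 * e i1 = 0] forces [a i1 = 0]; then [e i1] is zero, against
   freeness. *)
pose d (i : 'I_m.+2) := if i == i0 then a i1 else if i == i1 then - a i0 else 0.
have d0 : \sum_i d i *: e i = 0.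
  rewrite (bigD1 i0)//= (bigD1 i1)//= big1 => [|i /andP[/negPf h0 /negPf h1]].
    rewrite addr0 /d !eqxx/= !aE !ball_cstZ ball_cstD.
    by rewrite mulNr mulrC subrr; apply/funext => z;
        rewrite /ball_cst patchE if_same.
  by rewrite /d h0 h1 scale0r.
have a1 : a i1 = 0 by have := free _ d0 i0; rewrite /d eqxx.
pose d' (i : 'I_m.+2) : R[i] := (i == i1)%:R.
have d'0 : \sum_i d' i *: e i = 0.
  rewrite (bigD1 i1)//= big1 => [|i /negPf h1].
    rewrite addr0 aE ball_cstZ a1 mulr0.
    by apply/funext => z; rewrite /ball_cst patchE if_same.
  by rewrite /d' h1 scale0r.
by have /eqP := free _ d'0 i1; rewrite /d' eqxx oner_eq0.
Qed.

Lemma has_dim0 (E : set (Cn -> R[i])) : E `<=` [set 0] -> has_dim E 0.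
Proof.
move=> E0; exists (fun=> 0); split=> [[]//|c _ []//|v /E0 ->].
by exists (fun=> 0); rewrite big_ord0.
Qed.

Lemma has_dim0_uniq (E : set (Cn -> R[i])) m : E `<=` [set 0] -> has_dim E m ->
    m = 0%N.
Proof.
move=> E0 [e [Ee free _]]; case: m e Ee free => // m e Ee free.
have := free (fun i => (i == ord0)%:R) _ ord0; rewrite eqxx => h.
have /eqP : (1 : R[i]) = 0.
  by apply: h; rewrite big1// => i _; rewrite (E0 _ (Ee i)) scaler0.
by rewrite oner_eq0.
Qed.

(** The images are the constants [f k 0], bounded through [normc_eval0_le], so the claim comes down
    to bounded sequences of complex numbers. *)
Lemma compact_operator_eval0 : compact_operator H ip P.
Proof.
split; first exact: linear_operator_eval0.
move=> f Hf [M fM].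
have s0 : 0 < Num.sqrt vol by rewrite sqrtr_gt0 dV_ball_gt0.
have cM k : normc (f k 0) <= M / Num.sqrt vol.
  by rewrite ler_pdivlMr//; exact: le_trans (normc_eval0_le (Hf k)) (fM k).
have [l [lh [a [b [la lb]]]]] := @bolzano_weierstrass_pair R
  (fun k => complex.Re (f k 0)) (fun k => complex.Im (f k 0)) (M / Num.sqrt vol)
  (fun k => le_trans (normr_Re_le _) (cM k))
  (fun k => le_trans (normr_Im_le _) (cM k)).
exists l; split=> //; exists (ball_cst (a +i* b)%C); first exact: A2_ball_cst.
apply/cvgrPdist_lt => e e0.
have e1 : 0 < e / (2 * Num.sqrt vol) by rewrite divr_gt0// mulr_gt0.
move/cvgrPdist_lt/(_ _ e1): la => la; move/cvgrPdist_lt/(_ _ e1): lb => lb.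
near=> k.
rewrite sub0r normrN PE -[X in _ - X]scale1r -scaleNr ball_cstZ ball_cstD
    mulN1r.
rewrite hnorm_ball_cst ger0_norm; last by rewrite mulr_ge0 ?normc_ge0// ltW.
rewrite -ltr_pdivlMr//; apply: le_lt_trans (normc_le_ReIm _) _.
rewrite cReD cImD cReN cImN/=.
have h1 : `|a - complex.Re (f (l k) 0)| < e / (2 * Num.sqrt vol) by near: k.
have h2 : `|b - complex.Im (f (l k) 0)| < e / (2 * Num.sqrt vol) by near: k.
rewrite distrC [X in _ + X]distrC.
have -> : e / Num.sqrt vol = e / (2 * Num.sqrt vol) + e / (2 * Num.sqrt vol).
  by field; rewrite gt_eqF.
exact: ltrD.
Unshelve. all: by end_near. Qed.

(* For d := S (ball_cst c), pairing with the constant 1 gives d 0 = c;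
    pairing with d
   itself then gives equality in A2_mean_le. *)
Lemma adjoint_eval0 S c : is_adjoint H ip P S -> S (ball_cst c) = ball_cst c.
Proof.
move=> [HS adj]; pose d := S (ball_cst c).
have Hc : H (ball_cst c) by exact: A2_ball_cst.
have Hd : H d by exact: HS.
have v0 : (vol%:C)%C != 0 :> R[i].
  by apply/eqP => /complexI h; have := dV_ball_gt0 R n; rewrite h ltxx.
have E h : H h -> h 0 * c^*%C * vol%:C%C = ip h d.
  by move=> Hh; rewrite -adj// PE A2dot_ball_cstl// ball_cst0.
have d0 : d 0 = c.
  have := E _ (A2_ball_cst n 1); rewrite A2dot_ball_cstl// ball_cst0 !mul1r.
  by move/(mulIf v0) => /(congr1 (fun x => x^*%C)); rewrite !conjcK.
rewrite -/d -d0; apply: A2_mean_eq => //.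
by rewrite -E// d0 mulc_conj -rmorphM.
Qed.

(** One description for two cases: the line of constants when [mu = 1], and 0 otherwise. At the
    origin the eigenvalue equation reads [f 0 = mu ^+ 2 * f 0], which kills [f 0], and then [f],
    unless [mu = 1]. *)
Lemma eigenspace_eval0 S (mu : R) : is_adjoint H ip P S -> 0 < mu ->
  [set f | H f /\ S (P f) = ((mu ^+ 2)%:C)%C *: f] =
  [set f | exists2 c, f = ball_cst c & mu = 1 \/ c = 0].
Proof.
move=> adj mu0; have m2 : (((mu ^+ 2)%:C)%C : R[i]) != 0.
  by apply/eqP => /complexI h; have := exprn_gt0 2 mu0; rewrite h ltxx.
apply/seteqP; split => [f [Hf]|f [c -> [->|->]]] /=.
- rewrite PE (adjoint_eval0 _ adj) => E.
  have [mu1|mu1] := eqVneq mu 1.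
    exists (f 0); last by left.
    by rewrite E mu1 expr1n scale1r.
  have f0 : f 0 = 0.
    have := congr1 (fun f : Cn -> R[i] => f 0) E.
    rewrite ball_cst0 /= /GRing.scale/= => /eqP; rewrite -subr_eq0.
    rewrite -{1}[f 0]mul1r -mulrBl mulf_eq0 => /orP[|/eqP//].
    rewrite subr_eq0 => /eqP/complexI /esym/eqP.
    by rewrite sqrp_eq1 ?ltW// (negPf mu1).
  exists 0; last by right.
  apply: (scalerI m2).
  by rewrite -E f0 ball_cstZ mulr0.
- rewrite PE ball_cst0 (adjoint_eval0 _ adj) expr1n scale1r.
  by split => //; exact: A2_ball_cst.
- rewrite PE ball_cst0 (adjoint_eval0 _ adj) ball_cstZ mulr0.
  by split => //; exact: A2_ball_cst.
Qed.

(** The sequence qualifies with [P] as its own adjoint; to evaluate [xget], every admissible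
    sequence, for whatever adjoint [S], must also be shown equal to it. *)
Lemma singular_values_eval0 : singular_values H ip P = fun k => (k == 0)%:R.
Proof.
have line f : [set f : Cn -> R[i] | exists2 c, f = ball_cst c & (1 : R) = 1 \/
    c = 0] f <->
    exists c, f = ball_cst c.
  by split=> [[c -> _]|[c ->]]; exists c => //; left.
have trivial (mu : R) : mu != 1 ->
    [set f : Cn -> R[i] | exists2 c, f = ball_cst c & mu = 1 \/ c = 0] `<=`
        [set 0].
  move=> /eqP mu1 _ [c -> [//|->]] /=.
  by apply/funext => z; rewrite /ball_cst patchE if_same.
apply: xget_unique.
  have adj : is_adjoint H ip P P by have [] := orthogonal_projection_eval0.
  exists P => //; split.
  - by move=> k; exact: ler0n.
  - by move=> i j ij; rewrite ler_nat; case: i j ij => [|i] [|j].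
  - move=> mu mu0; rewrite eigenspace_eval0//.
    have [->|mu1] := eqVneq mu 1.
      exists 1%N; last exact: has_dim_line line.
      rewrite (_ : [set k | _] = [set 0%N]); first exact: card_set1.
      apply/seteqP; split => k /=; last by move=> ->.
      by case: k => // k /esym/eqP; rewrite oner_eq0.
    exists 0%N; last exact: has_dim0 (trivial _ mu1).
    rewrite II0 card_eq0; apply/eqP/seteqP; split => // k /=.
    by case: k => [/esym/eqP|k /= /esym/eqP];
        [rewrite (negPf mu1)|rewrite gt_eqF].
move=> s [S adj [s0 sd sm]].
(* A positive value other than 1 has a zero eigenspace, hence multiplicity 0, so [s] cannot take
   it. *)
have s01 k : s k = 0 \/ s k = 1.
  have [->|sk1] := eqVneq (s k) 1; [by right|left].
  apply: contrapT => /eqP sk0.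
  have skp : 0 < s k by rewrite lt_neqAle eq_sym sk0 s0.
  have [m cm] := sm _ skp; rewrite eigenspace_eval0// =>
      /(has_dim0_uniq (trivial _ sk1)) m0.
  by move: cm; rewrite m0 II0 card_eq0 => /eqP/seteqP[+ _] => /(_ k); exact.
have [m + ] := sm 1 ltr01; rewrite eigenspace_eval0// =>
    + /(has_dim_line_uniq line) m1.
rewrite m1 => /eq_cardSP[k /= sk1].
rewrite II0 card_eq0 => /eqP/seteqP[sub _].
(* The value 1 is taken at [k] only, and monotonicity puts it at index 0. *)
have s00 : s 0%N = 1.
  have [h|//] := s01 0%N.
  by have := sd _ _ (leq0n k); rewrite sk1 h ler10.
have uniq j : s j = 1 -> j = k.
  by move=> sj; apply: contrapT => jk; exact: (sub j).
apply/funext => -[|j]; first by rewrite s00.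
have [->//|h] := s01 j.+1.
by have := uniq _ h; rewrite -(uniq _ s00).
Qed.

Lemma schatten_norm_pow_eval0 (q : R) : 0 < q ->
    schatten_norm_pow H ip q P = 1%E.
Proof.
move=> q0; rewrite /schatten_norm_pow singular_values_eval0.
rewrite nneseries_recl//.
rewrite /= powR1 eseries0 ?adde0// => -[|k]// _ _.
(* A zero singular value contributes 0 because [q] is nonzero; with exponent 0 the power would be
   1. *)
by rewrite /= powR0// gt_eqF.
Qed.

End projection.

(** * The Berezin integral *)

Section dyadic.
Variable R : realType.
Implicit Types x : R.

Lemma dyadic_bracket x : 0 < x <= 1 -> exists k, 2^-1 ^+ k.+1 < x <= 2^-1 ^+ k.
Proof.
move=> /andP[x0 x1].
have ex : exists k, 2^-1 ^+ k.+1 < x.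
  exists (Num.Def.archi_bound x^-1); rewrite exprVn invf_plt ?posrE
      ?exprn_gt0//.
  apply: lt_le_trans (archi_boundP _) _; first by rewrite invr_ge0 ltW.
  by rewrite -natrX ler_nat ltnW// ltnW// ltn_expl.
case: (ex_minnP ex) => -[|k] hk min; first by exists 0%N; rewrite hk expr0.
exists k.+1; rewrite hk leNgt; apply/negP => /min.
by rewrite ltnn.
Qed.

(** The terms present are those with [2 ^+ k <= 1 / x], and a sum of successive powers of 2 is at
    most twice the last one. *)
Lemma sum_dyadic_le x K : 0 < x ->
  \sum_(k < K) 2 ^+ k * (x <= 2^-1 ^+ k)%R%:R <= 2 / x.
Proof.
move=> x0; elim: K => [|K IH]; first by rewrite big_ord0 divr_ge0// ltW.
rewrite big_ord_recr/=; have [xK|] := leP x; last by rewrite mulr0 addr0.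
rewrite mulr1; apply: (@le_trans _ _ (2 ^+ K + 2 ^+ K)).
  rewrite lerD2r; apply: (@le_trans _ _ (\sum_(k < K) 2 ^+ k)).
    apply: ler_sum => k _; rewrite ler_piMr ?exprn_ge0//.
    by rewrite lern1 leq_b1.
  elim: K {IH xK} => [|K IH]; first by rewrite big_ord0.
  by rewrite big_ord_recr/= exprS; lra.
rewrite -mulr2n -[X in X <= _]mulr_natl ler_pM2l//.
by rewrite -(invrK (2 ^+ K)) -exprVn lef_pV2// posrE exprn_gt0// invr_gt0.
Qed.

Lemma sum_geometric_le x K : 0 <= x < 1 -> \sum_(k < K) x ^+ k <= (1 - x)^-1.
Proof.
move=> /andP[x0 x1]; have x1' : 0 < 1 - x by lra.
rewrite -[leRHS]mul1r ler_pdivlMr// mulrC.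
have -> : (1 - x) * \sum_(k < K) x ^+ k = 1 - x ^+ K.
  by have := subrX1 x K; lra.
by rewrite lerBlDr lerDl exprn_ge0.
Qed.

(** Bernoulli's inequality, in the form that bounds the volume of a shell from above. *)
Lemma onem_expr_le x n : 0 <= x <= 1 -> 1 - (1 - x) ^+ n <= n%:R * x.
Proof.
move=> x01; elim: n => [|n IH]; first by rewrite expr0 subrr mul0r.
have h1 : (1 - x) ^+ n <= 1 by rewrite exprn_ile1//; lra.
rewrite exprS -natr1; nra.
Qed.

End dyadic.

(** * Volumes of boundary shells and the critical exponent *)

Section shells.
Variables (R : realType) (n : nat).
Hypothesis n_gt0 : (0 < n)%N.
Local Notation Cn := 'rV[R[i]]_n.
Local Notation dV := (@dV R n).
Local Notation B := (@unit_ball R n).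
Local Notation mB := (@measurable_unit_ball R n).
Local Notation vol := (fine (dV B)).

Let d (z : Cn) : R := 1 - sqnorm z.

Let d_bound z : B z -> 0 < d z <= 1.
Proof.
by rewrite unit_ballE /d/= => zB; rewrite subr_gt0 zB lerBlDr lerDl sqnorm_ge0.
Qed.

Let measurable_d : measurable_fun setT d.
Proof. by apply: measurable_funB => //; exact: measurable_sqnorm. Qed.

Let measurable_powRd (s : R) : measurable_fun setT (fun z => (d z `^ s)%:E).
Proof.
apply/measurable_EFinP; apply: (measurableT_comp (f := @powR R ^~ s)) => //.
Qed.

(** The shells are nested rather than disjoint annuli: each volume then comes from one sublevel set
    of [sqnorm], and the resulting overcounting is only geometric. *)
Definition boundary_shell (k : nat) : set Cn :=
    B `&` [set z | d z <= 2^-1 ^+ k].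

Lemma measurable_boundary_shell k : measurable (boundary_shell k).
Proof.
apply: measurableI; first exact: mB.
have := measurable_d measurableT (measurable_itv `]-oo, (2^-1 ^+ k : R)]).
by rewrite setTI set_itvE.
Qed.

Lemma dV_boundary_shell k :
  dV (boundary_shell k) = (vol * (1 - (1 - 2^-1 ^+ k) ^+ n))%:E.
Proof.
have k1 : 2^-1 ^+ k <= 1 :> R by rewrite exprn_ile1// ?invr_ge0// invf_le1//
    ler1n.
have k0 : 0 < 2^-1 ^+ k :> R by rewrite exprn_gt0// invr_gt0.
set t := 1 - 2^-1 ^+ k.
have mt : measurable [set z : Cn | sqnorm z < t].
  have := @measurable_sqnorm R n measurableT _ (measurable_itv `]-oo, t[).
  by rewrite setTI set_itvE.
have -> : boundary_shell k = B `\` [set z | sqnorm z < t].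
  apply/seteqP; split => z [zB] /=; rewrite /d /t => h; split => //=.
    by apply/negP; rewrite -leNgt; lra.
  have : 1 - 2^-1 ^+ k <= sqnorm z by rewrite leNgt; exact/negP.
  by rewrite /d; lra.
rewrite measureD//; [|exact: mB|exact: dV_ball_lty].
have -> : B `&` [set z | sqnorm z < t] = [set z | sqnorm z < t].
  by apply: setIidr => z /=; rewrite unit_ballE /t /=; lra.
have dVt : dV [set z | sqnorm z < t] = (t ^+ n * vol)%:E.
  (* For [k = 0] the inner radius is 0, outside the range of [dV_sqnorm_lt]; there [0 ^+ n = 0]
     because [n > 0]. *)
  have [t0|t0] := ltP 0 t.
    by rewrite dV_sqnorm_lt// -{1}(fineK (@dV_ball_fin_num R n)) -EFinM.
  have -> : t = 0 by apply/le_anti; rewrite t0 /t; lra.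
  rewrite expr0n gtn_eqF// mul0r (_ : [set z | _] = set0) ?measure0//.
  by apply/seteqP; split => // z /=; rewrite ltNge sqnorm_ge0.
rewrite [X in (_ - X)%E]dVt -[X in (X - _)%E](fineK (@dV_ball_fin_num R n))
    -EFinB.
by congr EFin; ring.
Qed.

Lemma dV_boundary_shell_ge k : ((vol * 2^-1 ^+ k)%:E <= dV (boundary_shell
    k))%E.
Proof.
rewrite dV_boundary_shell lee_fin ler_pM2l ?dV_ball_gt0//.
have k1 : 2^-1 ^+ k <= 1 :> R by rewrite exprn_ile1// ?invr_ge0// invf_le1//
    ler1n.
have k0 : 0 < 2^-1 ^+ k :> R by rewrite exprn_gt0// invr_gt0.
have : (1 - 2^-1 ^+ k) ^+ n <= 1 - 2^-1 ^+ k :> R.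
  by rewrite -[leRHS]expr1 ler_wiXn2l//; lra.
lra.
Qed.

Lemma dV_boundary_shell_le k :
  (dV (boundary_shell k) <= (vol * (n%:R * 2^-1 ^+ k))%:E)%E.
Proof.
rewrite dV_boundary_shell lee_fin ler_pM2l ?dV_ball_gt0//.
apply: onem_expr_le; rewrite exprn_ge0 ?invr_ge0//=.
by rewrite exprn_ile1// ?invr_ge0// invf_le1// ler1n.
Qed.

Lemma integral_shell_indic k (c : R) : 0 <= c ->
  (\int[dV]_(z in B) (c * \1_(boundary_shell k) z)%:E = c%:E * dV
      (boundary_shell k))%E.
Proof.
move=> c0; under eq_integral do rewrite EFinM.
rewrite ge0_integralZl//; last 2 first.
- exact: mB.
- apply/measurable_EFinP; apply: measurable_indic;
    exact: measurable_boundary_shell.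
rewrite integral_indic//; [|exact: mB|exact: measurable_boundary_shell].
by rewrite /boundary_shell setIAC setIid.
Qed.

(** The [k]-th shell has measure at least [vol * 2^-k], so its indicator weighted by [2^k / 2] has
    integral at least [vol / 2]. The sum over [K] shells therefore integrates to at least
    [K * vol / 2], while pointwise it stays below [1 / d]. *)
Lemma integral_powR_infty (s : R) : s <= -1 ->
  (\int[dV]_(z in B) (d z `^ s)%:E = +oo)%E.
Proof.
move=> s1; apply/eqyP => A A0.
have [K AK] : exists K : nat, A <= K%:R * (vol / 2).
  exists (Num.Def.archi_bound (A / (vol / 2))).
  have v2 : 0 < vol / 2 by rewrite divr_gt0// dV_ball_gt0.
  by rewrite -ler_pdivrMr// ltW// archi_boundP// divr_ge0// ltW.
apply: (@le_trans _ _ (\int[dV]_(z in B)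
    (\sum_(k < K) (2^-1 * 2 ^+ k * \1_(boundary_shell k) z)%:E))%E); last first.
  apply: ge0_le_integral => //.
  - exact: mB.
  - by move=> z _; apply: sume_ge0 => k _; rewrite lee_fin !mulr_ge0//
      exprn_ge0.
  - apply: emeasurable_sum => k; apply/measurable_EFinP.
    apply: measurable_funM => //; apply: measurable_indic.
    exact: measurable_boundary_shell.
  - exact: measurable_funTS.
  move=> z zB; have /andP[dz0 dz1] := d_bound zB.
  rewrite sumEFin lee_fin.
  apply: (@le_trans _ _ (d z)^-1).
    apply: (@le_trans _ _ (2^-1 * (2 / d z)));
        last by rewrite mulrA mulVf// mul1r.
    apply: le_trans (ler_wpM2l _ (sum_dyadic_le K dz0));
        last by rewrite invr_ge0.
    rewrite mulr_sumr; apply: ler_sum => k _; rewrite mulrA.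
    rewrite ler_wpM2l// ?mulr_ge0 ?invr_ge0 ?exprn_ge0//.
    rewrite indicE /boundary_shell; case: (boolP (_ \in _)) => //.
    by rewrite inE => -[_ /= dk]; rewrite dk.
  (* Since [0 < d z <= 1], powers decrease in the exponent, so the exponent -1 is the extreme
     case. *)
  by rewrite -powR_inv1 ?(ltW dz0)//; apply: ger_powR; rewrite ?dz0.
rewrite ge0_integral_sum//; last 2 first.
- exact: mB.
- move=> k; apply/measurable_EFinP; apply: measurable_funM => //.
  by apply: measurable_indic; exact: measurable_boundary_shell.
apply: (@le_trans _ _ (\sum_(k < K) (vol / 2)%:E)%E).
  by rewrite sumEFin lee_fin sumr_const card_ord -[leRHS]mulr_natl.
apply: lee_sum => k _; rewrite integral_shell_indic ?mulr_ge0 ?exprn_ge0//.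
apply: le_trans (lee_wpmul2l _ (dV_boundary_shell_ge k)); last first.
  by rewrite lee_fin mulr_ge0 ?exprn_ge0.
rewrite -EFinM lee_fin le_eqVlt; apply/orP; left; apply/eqP.
have h : (2 : R) ^+ k * 2^-1 ^+ k = 1 by rewrite -exprMn mulfV// expr1n.
transitivity (vol / 2 * (2 ^+ k * 2^-1 ^+ k)); first by rewrite h mulr1.
ring.
Qed.

Lemma integral_powR_lty (s : R) : -1 < s ->
  (\int[dV]_(z in B) (d z `^ s)%:E < +oo)%E.
Proof.
move=> s1; have [s0|s0] := leP 0 s.
  apply: (@le_lt_trans _ _ (\int[dV]_(z in B) (cst 1%:E z))%E).
    apply: ge0_le_integral => //.
    - exact: mB.
    - by move=> z _; rewrite lee_fin powR_ge0.
    - exact: measurable_funTS.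
    move=> z /d_bound dz; have /andP[_ dz1] := dz.
    by rewrite lee_fin -(powRr0 (d z)); exact: ger_powR.
  by rewrite integral_cst ?mul1e ?dV_ball_lty//; exact: mB.
have [r [r0 r1 sE]] : exists r, [/\ 0 < r, r < 1 & s = - r] by exists (- s);
    split; lra.
have h2 : 0 < 2^-1 :> R by rewrite invr_gt0.
pose c : R := 2^-1 `^ r; have c0 : 0 < c by exact: powR_gt0.
pose x : R := 2^-1 `^ (1 - r).
have x0 : 0 <= x by exact: powR_ge0.
have x1 : x < 1.
  have r1' : 0 < 1 - r by rewrite subr_gt0.
  have := gt0_ltr_powR r1' (_ : 2^-1 \in Num.nneg) (_ : 1 \in Num.nneg).
  by rewrite powR1; apply; rewrite ?nnegrE ?invf_lt1 ?ltr1n// ltW.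
have cx : c^-1 * 2^-1 = x.
  have h : 2^-1 = x * c by rewrite /x /c -powRD ?subrK ?powRr1 ?ltW// gt_eqF
      ?implybT.
  by rewrite [X in _ * X]h mulrCA mulVf ?mulr1// gt_eqF.
(* On the k-th shell (1 - |z|^2)^s is at most c^-(k+1), and the shell has
    measure
   O(2^-k): the resulting series is geometric of ratio c^-1 / 2 = x < 1. *)
pose f k (z : Cn) : \bar R := (c^-1 ^+ k.+1 * \1_(boundary_shell k) z)%:E.
have ci k : 0 <= c^-1 ^+ k by rewrite exprn_ge0// invr_ge0 ltW.
have f0 k z : (0 <= f k z)%E by rewrite lee_fin mulr_ge0.
have mf k : measurable_fun B (f k).
  apply/measurable_EFinP; apply: measurable_funTS; apply: measurable_funM => //.
  by apply: measurable_indic; exact: measurable_boundary_shell.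
apply: (@le_lt_trans _ _ (\int[dV]_(z in B) (\sum_(k <oo) f k z))%E).
  apply: ge0_le_integral => //.
  - exact: mB.
  - by move=> z _; rewrite lee_fin powR_ge0.
  - exact: measurable_funTS.
  - by apply: ge0_emeasurable_sum.
  move=> z zB; have dz := d_bound zB; have [K /andP[K1 K2]] :=
      dyadic_bracket dz.
  (* A single term suffices: the one for the [K] with [2^-(K+1) < d z <= 2^-K]; the upper bound puts
     [z] in the shell, the lower one controls the power. *)
  apply: le_trans (nneseries_lim_ge K.+1 _); last by [].
  rewrite big_nat_recr//=; apply: le_trans (leeDr _ _); last by apply: sume_ge0.
  rewrite /f lee_fin indicE mem_set; last by split.
  rewrite mulr1 sE powRN exprVn lef_pV2 ?posrE ?exprn_gt0 ?powR_gt0//;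
      last first.
    by case/andP: dz.
  rewrite /c -powR_mulrn ?powR_ge0// powRAC powR_mulrn ?(ltW h2)//.
  have /andP[dz0 _] := dz.
  by apply: ge0_ler_powR; rewrite ?nnegrE ?exprn_ge0 ?(ltW h2) ?(ltW dz0) ?(ltW
      K1) ?(ltW r0).
rewrite integral_nneseries//; last exact: mB.
pose M := vol * n%:R * c^-1 * (1 - x)^-1.
apply: (@le_lt_trans _ _ M%:E); last exact: ltry.
apply: lime_le; first by apply: is_cvg_nneseries => k _ _; apply: integral_ge0.
apply: nearW => N.
apply: (@le_trans _ _ (\sum_(0 <= k < N) (vol * n%:R * c^-1 * x ^+ k)%:E)%E).
  apply: lee_sum => k _; rewrite /f integral_shell_indic//.
  apply: le_trans (lee_wpmul2l _ (dV_boundary_shell_le k)) _;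
      first by rewrite lee_fin.
  rewrite -EFinM lee_fin le_eqVlt; apply/orP; left; apply/eqP.
  by rewrite -cx exprMn exprS; ring.
rewrite sumEFin lee_fin -mulr_sumr big_mkord ler_wpM2l//.
  by rewrite !mulr_ge0// ?invr_ge0 (ltW c0, ltW (dV_ball_gt0 R n)).
by apply: sum_geometric_le; rewrite x0.
Qed.

Lemma Re_bergman_kernel (z : Cn) :
  complex.Re (bergman_kernel z z) = vol^-1 * d z ^- n.+1.
Proof.
rewrite /bergman_kernel cdotzz -(rmorph1 (real_complex R)) -rmorphB -rmorphXn.
by rewrite -fmorphV -rmorphM.
Qed.

Lemma bergman_kernel0r (z : Cn) : bergman_kernel z 0 = (vol^-1)%:C%C.
Proof.
rewrite /bergman_kernel (_ : cdot z 0 = 0) ?subr0 ?expr1n ?invr1 ?mulr1//.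
by rewrite /cdot big1// => j _; rewrite mxE conjc0 mulr0.
Qed.

(** [K(z, 0)] is the constant [1 / |B|], so its square integrates to [1 / |B|], which cancels the
    normalising constant of [K(z, z)]. *)
Lemma berezin_eval0 (z : Cn) :
  berezin (cst 1) (cst (0 : Cn)) z = (d z ^+ n.+1)%:E.
Proof.
have v0 := dV_ball_gt0 R n.
rewrite /berezin Re_bergman_kernel.
rewrite (eq_integral (fun=> (vol^-1 ^+ 2)%:E)); last first.
  move=> w _; rewrite bergman_kernel0r (ComplexField.Normc.normc1 R) expr1n
      mulr1.
  by rewrite sqr_normc_ReIm/= expr0n addr0.
rewrite integral_cst; last exact: mB.
rewrite -[X in (_ * (_ * X))%E](fineK (@dV_ball_fin_num R n)) -!EFinM;
    congr EFin.
rewrite invfM !invrK expr2; field; rewrite gt_eqF//.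
Qed.

(** In the exponent, [(n + 1) * (q / 2)] comes from the Berezin transform and [- (n + 1)] from the
    density of the invariant measure. *)
Lemma berezin_integral_eval0 (q : R) :
  berezin_integral q (cst 1) (cst (0 : Cn)) =
  (vol^-1%:E * \int[dV]_(z in B) (d z `^ (n.+1%:R * (q / 2) - n.+1%:R))%:E)%E.
Proof.
rewrite /berezin_integral -ge0_integralZl//; last 4 first.
- exact: mB.
- exact: measurable_funTS.
- by move=> z _; rewrite lee_fin powR_ge0.
- by rewrite lee_fin invr_ge0 ltW// dV_ball_gt0.
apply: eq_integral => z; rewrite inE => /d_bound/andP[dz0 _].
rewrite berezin_eval0 Re_bergman_kernel poweR_EFin -!EFinM; congr EFin.
rewrite powRB; last by rewrite (gt_eqF dz0) implybT.
rewrite (powRrM _ n.+1%:R) !powR_mulrn ?(ltW dz0)//.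
exact: mulrCA.
Qed.

Lemma berezin_integral_eval0_lty (q : R) :
  (berezin_integral q (cst 1%R) (cst (0%R : Cn)) < +oo)%E <->
      (2 * n)%:R / n.+1%:R < q.
Proof.
rewrite berezin_integral_eval0.
have v0 : 0 < vol^-1 by rewrite invr_gt0 dV_ball_gt0.
(* Origin of the critical value: [(n + 1) * (q / 2 - 1) > -1] rearranges to
   [(n + 1) * q > 2 * n]. *)
have E : ((2 * n)%:R / n.+1%:R < q) = (-1 < n.+1%:R * (q / 2) - n.+1%:R).
  rewrite ltr_pdivrMr// natrM -(natr1 n); apply/idP/idP; lra.
rewrite E; split => [|s1]; last first.
  by rewrite lte_mul_pinfty ?lee_fin ?(ltW v0)//; exact: integral_powR_lty.
apply: contraTT; rewrite -!leNgt => s1.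
by rewrite integral_powR_infty// gt0_muley ?lte_fin.
Qed.

End shells.

Theorem proposition5p4 (R : realType) (n : nat) (n_ge1 : (1 <= n)%N) :
  let W := @weighted_comp R n in
  let one : 'rV[R[i]]_n -> R[i] := cst 1 in
  let zero : 'rV[R[i]]_n -> 'rV[R[i]]_n := cst 0 in
  let S := schatten_class (@A2 R n) (@A2dot R n) in
  let I := @berezin_integral R n in
  let q0 : R := (2 * n)%:R / n.+1%:R in
  [/\ orthogonal_projection (@A2 R n) (@A2dot R n) (W one zero) /\
        has_rank (@A2 R n) (W one zero) 1,
      forall q : R, 0 < q ->
        S q (W one zero) /\
        schatten_norm_pow (@A2 R n) (@A2dot R n) q (W one zero) = 1%E,
      forall q : R, 0 < q ->
        ((I q one zero < +oo)%E <-> q0 < q) &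
      forall q : R, 0 < q -> q <= q0 ->
        ~ (forall (u : 'rV[R[i]]_n -> R[i]) (phi : 'rV[R[i]]_n -> 'rV[R[i]]_n),
             ball_holomorphic u -> ball_holomorphic_self_map phi ->
             S q (W u phi) -> (I q u phi < +oo)%E)].
Proof.
move=> W one zero S I q0.
have SW q : 0 < q -> S q (W one zero).
  move=> q_gt0; split; first exact: compact_operator_eval0.
  by rewrite schatten_norm_pow_eval0// ltry.
have IW q : 0 < q -> (I q one zero < +oo)%E <-> q0 < q.
  by move=> _; exact: berezin_integral_eval0_lty.
split.
- by split; [exact: orthogonal_projection_eval0|exact: has_rank_eval0].
- by move=> q q_gt0; split; [exact: SW|exact: schatten_norm_pow_eval0].
- exact: IW.
- move=> q q_gt0 qq0 /(_ one zero) imp.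
  have /(IW _ q_gt0) : (I q one zero < +oo)%E.
    apply: imp; last exact: SW.
    + by move=> z _; exact: differentiable_cst.
    + by split=> [z _|z _]; [exact: differentiable_cst|exact: unit_ball0].
  by rewrite ltNge qq0.
Qed.
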